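(* For any Borel-on-Borel $\sigma$-ideal $\mathcal I$ with $\bigcup\mathcal I=2^\omega\notin\mathcal I$, the semi-ideal $\mathcal{HI}$ on any non-locally compact Polish group $X$ has $\mathrm{add}(\mathcal{HI})\le\omega_1$.
   Context: All groups are Abelian, written additively; a Polish group is a topological group whose underlying space is Polish. A $\sigma$-ideal on a set is a nonempty family of subsets closed under taking subsets and countable unions. A family $\mathcal I$ of subsets of $2^\omega=\{0,1\}^\omega$ is Borel-on-Borel if for any Polish space $Y$ and any Borel set $A\subset 2^\omega\times Y$ the set $\{y\in Y:\{z\in 2^\omega:(z,y)\in A\}\in\mathcal I\}$ is Borel in $Y$. A subset $A$ of a Polish group $X$ is Haar-$\mathcal I$ if there is a continuous map $f:2^\omega\to X$ with $f^{-1}(A+x)\in\mathcal I$ for all $x\in X$; $\mathcal{HI}$ is the family of all subsets of Borel Haar-$\mathcal I$ sets in $X$. For a semi-ideal $\mathcal J$ (nonempty family closed under subsets) on $X$ with $X=\bigcup\mathcal J\notin\mathcal J$, $\mathrm{add}(\mathcal J)=\min\{|\mathcal A|:\mathcal A\subset\mathcal J,\ \bigcup\mathcal A\notin\mathcal J\}$. *)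

(* Defs.v *)
From HB Require Import structures.
From mathcomp Require Import all_boot all_order all_algebra.
From mathcomp Require Import all_classical all_reals all_analysis.
From mathcomp Require wochoice.

Set Implicit Arguments.
Unset Strict Implicit.
Unset Printing Implicit Defensive.

Import Order.TTheory GRing.Theory Num.Theory.
Import numFieldNormedType.Exports.

Local Open Scope classical_set_scope.
Local Open Scope card_scope.
Local Open Scope ring_scope.

Definition separable_space (T : topologicalType) : Prop :=
  exists2 D : set T, countable D & dense D.

Definition homeomorphic (T U : topologicalType) : Prop :=
  exists (f : T -> U) (g : U -> T),
    [/\ continuous f, continuous g, cancel f g & cancel g f].

Definition complete_metric (R : realType) (M : metricType R) : Prop :=
  forall F : set_system M, ProperFilter F -> cauchy F -> exists x : M, F --> x.

Definition completely_metrizable (R : realType) (T : topologicalType) : Prop :=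
  exists2 M : metricType R, complete_metric M & homeomorphic T M.

Definition polish (R : realType) (T : topologicalType) : Prop :=
  separable_space T /\ completely_metrizable R T.

Definition borel (T : topologicalType) : set (set T) :=
  <<s [set A : set T | open A] >>.

Definition sigma_ideal (T : Type) (I : set (set T)) : Prop :=
  [/\ I !=set0,
      (forall A B : set T, A `<=` B -> I B -> I A) &
      (forall F : (set T)^nat, (forall n, I (F n)) -> I (\bigcup_n F n))].

Definition borel_on_borel (R : realType) (I : set (set cantor_space)) : Prop :=
  forall (Y : topologicalType) (A : set (cantor_space * Y)),
    polish R Y -> borel A -> borel [set y : Y | I [set z | A (z, y)]].

Definition haar (I : set (set cantor_space)) (X : topologicalZmodType)
    (A : set X) : Prop :=
  exists2 f : cantor_space -> X, continuous f &
    forall x : X, I (f @^-1` [set a + x | a in A]).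

Definition HI (I : set (set cantor_space)) (X : topologicalZmodType) :
    set (set X) :=
  [set A | exists B : set X, [/\ A `<=` B, borel B & haar I B]].

Arguments HI I X : clear implicits.

(* [is_add J A] : the cardinal add(J) exists and is equal to |A|. *)
Definition is_add (T : Type) (J : set (set T)) (A : set (set T)) : Prop :=
  [/\ A `<=` J, ~ J (\bigcup_(B in A) B) &
      forall A' : set (set T), A' `<=` J -> ~ J (\bigcup_(B in A') B) ->
        A #<= A'].

(* A countable ordinal is the order type of a well-ordering of a subset of    *)
(* nat. Such a well-ordering is coded by a single relation, which orders the  *)
(* set of its reflexive points; its values elsewhere are ignored.             *)
Definition wo_field (R : rel nat) : {pred nat} := [pred n | R n n].

Definition well_ordering (R : rel nat) : Prop := wochoice.wo_chain R (wo_field R).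

Definition order_iso (R S : rel nat) : Prop :=
  exists2 f : nat -> nat, set_bij [set` wo_field R] [set` wo_field S] f &
    {in wo_field R &, forall m n, S (f m) (f n) = R m n}.

Definition order_type (R : rel nat) : set (rel nat) :=
  [set S | well_ordering S /\ order_iso R S].

(* Hartogs' construction: omega_1 is the set of all countable ordinals.       *)
Definition omega1 : set (set (rel nat)) :=
  [set order_type R | R in [set R | well_ordering R]].

(* Main.v *)
Require Import Defs.
From HB Require Import structures.
From mathcomp Require Import all_boot all_order all_algebra.
From mathcomp Require Import all_classical all_reals all_analysis.
From mathcomp Require Import zify.

(** The family that witnesses the bound has one member for each countable
    ordinal, because the Borel subsets of X are produced in omega_1 stages. A
    stage is coded by a well-ordering S of a set of naturals, and [hierarchy]
    provides a universal set for that stage: a jointly Borel family V(c), with c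
    ranging over functions from nat to nat, whose members are exactly the sets of
    that stage. For each S, [haar_borel_avoiding] gives a Borel Haar-I set E_S
    contained in no Haar-I set V(c). Every Borel set has a stage
    ([borel_ranked]), so no Borel Haar-I set contains all the E_S, and
    the union of the E_S is not in HI. The stages depend on S only through its
    order type ([order_iso_rank]), which leaves at most omega_1 sets. Finally,
    among the families that violate additivity one has least cardinality, by
    [least_cardinal].

    The set E_S diagonalizes over all pairs (c, f) where f is a continuous map
    from the Cantor space to X; such a pair is coded by some p : nat -> nat, and
    f is written ev(p). Since X is not locally compact, there are translations
    t(p) that spread the compact sets f(2^omega) + t(p) so far apart that p can
    be read off from any of their points, and that no difference of points lying
    over different codes belongs to K - K, where K is the image of a continuous
    injection g of the Cantor space, fixed beforehand
    ([spread_translations], [cantor_embedding]). If f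
    witnesses that V(c) is Haar-I, then the set of z with f(z) + t(p) outside
    V(c) is not in I, being the complement of a set in I. Choosing one such
    z for each p and putting f(z) + t(p) into E_S makes E_S escape from V(c).
    Moreover E_S has at most one point over each p, so each translate of E_S
    meets K in at most one point, and g witnesses that E_S is Haar-I.

    The choice of z must be Borel in p. This is a uniformization of a Borel set
    along its sections that are not in I ([luzin_uniformization]). It is
    done greedily along a countable system of Borel covers, and the hypothesis
    that I is Borel-on-Borel makes each greedy decision Borel. The code p is
    represented by the point t(p), so the only Polish space of parameters that
    occurs is X itself.

    The spreading uses smallness with respect to the group structure, so limits of
    series must exist for sequences that are Cauchy in that sense, whereas the
    complete metric of X need not be invariant under translations. Klee's
    argument, [cauchy_converges], bridges the gap. *)

Set Implicit Arguments.
Unset Strict Implicit.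
Unset Printing Implicit Defensive.

Import Order.TTheory GRing.Theory Num.Theory.
Import numFieldNormedType.Exports.

Local Open Scope classical_set_scope.
Local Open Scope card_scope.
Local Open Scope ring_scope.

(** * Scales of neighbourhoods of zero in an abelian group *)

Lemma completely_metrizable_hausdorff (R : realType) (T : topologicalType) :
  completely_metrizable R T -> hausdorff_space T.
Proof.
case=> M _ [f [g [cf cg fK gK]]] x y xy.
apply: (can_inj fK); apply: metric_hausdorff => A B fxA fyB.
have [z [Az Bz]] := xy _ _ (cf x _ fxA) (cf y _ fyB).
by exists (f z).
Qed.

(** Completeness in the form used below: balls of radius 1/(k+1), transported
    along the homeomorphism, certify convergence of a sequence as soon as all
    later terms stay in the k-th ball around the k-th term. *)
Lemma completely_metrizable_balls (R : realType) (T : topologicalType) :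
    completely_metrizable R T ->
  exists N : nat -> T -> set T,
    [/\ forall k (x : T), nbhs x (N k x),
        forall (x : T) U, nbhs x U -> exists k, N k x `<=` U &
        forall y : nat -> T, (forall n m, (n <= m)%N -> N n (y n) (y m)) ->
          exists l : T, y @ \oo --> l].
Proof.
case=> M Mcomplete [f [g [cf cg fK gK]]].
exists (fun k x => f @^-1` ball (f x) k.+1%:R^-1); split.
- by move=> k x; apply: (cf x); apply: nbhsx_ballx; rewrite invr_gt0.
- move=> x U xU.
  have : nbhs (f x) (g @^-1` U) by apply: (cg (f x)); rewrite /= fK.
  move=> /nbhs_ballP[e /= e0 eU].
  have [k ke] : exists k : nat, k.+1%:R^-1 <= e.
    exists (Num.truncn e^-1); rewrite invf_ple ?posrE// ltW//.
    exact: truncnS_gt.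
  exists k => y /(le_ball ke)/eU.
  by rewrite /= fK.
- move=> y yN.
  have [l fl] : exists l : M, (f \o y) @ \oo --> l.
    apply: Mcomplete; apply/cauchy_ballP => _/posnumP[e].
    have [k ke] : exists k : nat, k.+1%:R^-1 <= e%:num / 2.
      exists (Num.truncn (e%:num / 2)^-1).
      by rewrite invf_ple ?posrE// ltW//; apply: truncnS_gt.
    exists (f @` [set z | exists2 n, (k <= n)%N & z = y n],
            f @` [set z | exists2 n, (k <= n)%N & z = y n]) => /=.
      by split; exists k => // n kn; exists (y n) => //; exists n.
    move=> [_ _] [/= [_ [n kn ->] <-] [_ [m km ->] <-]].
    apply: (@ball_splitr _ _ (f (y k))); apply: (le_ball ke); exact: yN.
  exists (g l).
  have -> : y = g \o (f \o y) by apply/funext => n /=; rewrite fK.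
  by apply: cvg_comp fl _; apply: cg.
Qed.

(** A base of neighbourhoods of zero that plays the role of the balls of radius
    2^-n of an invariant metric. *)
Definition group_scale (X : topologicalZmodType) (U : nat -> set X) : Prop :=
  [/\ (forall n, open (U n)) /\ (forall n, U n 0),
      forall n x, U n x -> U n (- x),
      forall n x y, U n.+1 x -> U n.+1 y -> U n (x + y) &
      forall V, nbhs 0 V -> exists n, U n `<=` V].

Section Scale.
Variable X : topologicalZmodType.
Implicit Types (x y : X) (V : set X).

Lemma nbhs_shift x V : nbhs x V -> nbhs 0 [set y | V (x + y)].
Proof.
move=> xV.
have c : (fun y => x + y) @ (0 : X) --> x + 0.
  apply: (@continuous_comp _ _ _ (fun y : X => (x, y)) (fun z : X * X => z.1 + z.2)).
    by apply: cvg_pair => /=; [exact: cvg_cst|exact: cvg_id].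
  exact: add_continuous.
by apply: c; rewrite addr0.
Qed.

Lemma shift_nbhs x V : nbhs 0 V -> nbhs x [set y | V (y - x)].
Proof.
move=> V0.
have c : (fun y => y - x) @ x --> x - x.
  apply: (@continuous_comp _ _ _ (fun y : X => (y, x)) (fun z : X * X => z.1 - z.2)).
    by apply: cvg_pair => /=; [exact: cvg_id|exact: cvg_cst].
  exact: sub_continuous.
by apply: c; rewrite subrr.
Qed.

Lemma open_shift x V : open V -> open [set y | V (y - x)].
Proof.
move=> oV; apply: (open_comp _ oV) => y _.
apply: (@continuous_comp _ _ _ (fun y : X => (y, x)) (fun z : X * X => z.1 - z.2)).
  by apply: cvg_pair => /=; [exact: cvg_id|exact: cvg_cst].
exact: sub_continuous.
Qed.

Lemma nbhs_half V : nbhs 0 V ->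
  exists W, [/\ open W, W 0, forall x, W x -> W (- x) &
    forall x y, W x -> W y -> V (x + y)].
Proof.
move=> V0.
have : nbhs ((0, 0) : X * X) [set z | V (z.1 + z.2)].
  by apply: (@add_continuous X (0, 0)); rewrite /= addr0.
move=> [[A B] [/= A0 B0] AB].
have : nbhs 0 (A `&` B) by apply: filterI.
rewrite nbhsE => -[W [oW W0] WAB].
exists (W `&` -%R @^-1` W); split.
- by apply: openI => //; apply: open_comp oW => y _; apply: opp_continuous.
- by split; rewrite /= ?oppr0.
- by move=> x [Wx WNx]; split; rewrite /= ?opprK.
- move=> x y [Wx _] [Wy _]; apply: (AB (x, y)).
  by split; [case: (WAB x)|case: (WAB y)].
Qed.

(** Passing to a fast subsequence preserves the halving property, since the
    members of a scale decrease; P records any additional gap that is wanted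
    between consecutive members. *)
Lemma group_scale_subseq (U : nat -> set X) (P : nat -> nat -> Prop) :
    group_scale U -> (forall n, exists m, P n m) ->
    (forall n m m', (m <= m')%N -> P n m -> P n m') ->
  exists2 phi : nat -> nat, group_scale (U \o phi) &
    forall n, P (phi n) (phi n.+1).
Proof.
move=> [[oU U0] UN UD Ub] exP Pmono.
have [F PF] := choice exP.
pose phi := fix phi n := if n is n'.+1 then maxn (F (phi n')) (phi n').+1 else 0%N.
have Umono n m : (n <= m)%N -> U m `<=` U n.
  elim: m => [|m IH]; first by rewrite leqn0 => /eqP ->.
  rewrite leq_eqVlt => /orP[/eqP -> //|nm] x Ux; apply: IH => //.
  by rewrite -[x]addr0; apply: UD => //.
have phi_ge n : (n <= phi n)%N.
  by elim: n => // n IH; rewrite /= leq_max ltnS IH orbT.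
exists phi; last by move=> n; apply: Pmono (PF _); rewrite /= leq_maxl.
split => [||n x y Ux Uy|V /Ub[n UV]].
- by split=> n; [apply: oU|apply: U0].
- by move=> n; apply: UN.
- by apply: UD; [move: Ux|move: Uy]; apply: Umono; rewrite /= leq_maxr.
- by exists n => x /= /(Umono _ _ (phi_ge n))/UV.
Qed.

End Scale.

Lemma group_scale_exists (R : realType) (X : topologicalZmodType) :
  completely_metrizable R X -> exists U : nat -> set X, group_scale U.
Proof.
move=> /completely_metrizable_balls[N [N0 Nb _]].
have exH V : exists W, nbhs 0 V -> [/\ open W, W 0, forall x, W x -> W (- x) &
    forall x y : X, W x -> W y -> V (x + y)].
  have [/nbhs_half[W ?]|] := pselect (nbhs 0 V); first by exists W.
  by exists V.
have [H HP] := choice exH.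
pose U := fix U n := if n is n'.+1 then H (U n' `&` N n' 0) else H setT.
have HU n : exists2 V, nbhs 0 V & U n = H V.
  elim: n => [|n [V V0 UV]]; first by exists setT => //; apply: filterT.
  exists (U n `&` N n 0) => //; apply: filterI => //.
  by rewrite UV; apply: open_nbhs_nbhs; have [] := HP _ V0.
have Unb n : nbhs 0 (U n).
  by have [V V0 ->] := HU n; apply: open_nbhs_nbhs; have [] := HP _ V0.
have Ub0 n : nbhs 0 (U n `&` N n 0) by apply: filterI.
exists U; split.
- by split=> n; have [V V0 ->] := HU n; have [] := HP _ V0.
- by move=> n x; have [V V0 ->] := HU n; have [_ _ + _] := HP _ V0; apply.
- move=> n x y Ux Uy; have [_ _ _ /(_ x y)] := HP _ (Ub0 n).
  by move=> /(_ Ux Uy)[].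
- move=> V /Nb[k kV]; exists k.+1 => x Ux; apply: kV.
  have [_ H0 _ /(_ x 0)] := HP _ (Ub0 k).
  by rewrite addr0 => /(_ Ux H0)[].
Qed.

(** ** Equalities in abelian groups *)

(** The tactic [zmod] proves an equality between sums in a zmodType, by comparing
    the integer coefficients of the atoms on both sides. *)
Inductive zexp := ZVar of nat | ZZero | ZAdd of zexp & zexp | ZOpp of zexp.

Fixpoint zeval (X : zmodType) (env : seq X) e : X :=
  match e with
  | ZVar i => nth 0 env i
  | ZZero => 0
  | ZAdd a b => zeval env a + zeval env b
  | ZOpp a => - zeval env a
  end.

Fixpoint zcoef e (i : nat) : int :=
  match e with
  | ZVar j => (i == j)%:Z
  | ZZero => 0
  | ZAdd a b => zcoef a i + zcoef b i
  | ZOpp a => - zcoef a i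
  end.

Lemma zevalE (X : zmodType) (env : seq X) e :
  zeval env e = \sum_(i < size env) nth 0 env i *~ zcoef e i.
Proof.
elim: e => [j||a IHa b IHb|a IHa] /=.
- have [jlt|jge] := ltnP j (size env).
    rewrite (bigD1 (Ordinal jlt))//= eqxx mulr1z big1 ?addr0// => i.
    by rewrite -val_eqE /= => /negPf ->.
  rewrite nth_default// big1// => i _.
  by rewrite (ltn_eqF (leq_trans (ltn_ord i) jge)).
- by rewrite big1.
- by rewrite IHa IHb -big_split; apply: eq_bigr => i _; rewrite mulrzDr.
- by rewrite IHa -sumrN; apply: eq_bigr => i _; rewrite mulrNz.
Qed.

Lemma zeval_eq (X : zmodType) (env : seq X) a b :
  all (fun i => zcoef a i == zcoef b i) (iota 0 (size env)) ->
  zeval env a = zeval env b.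
Proof.
move=> /allP eqab; rewrite !zevalE; apply: eq_bigr => i _.
by rewrite (eqP (eqab _ _))// mem_iota add0n leq0n ltn_ord.
Qed.

Ltac zmod_find x env :=
  lazymatch env with
  | x :: _ => constr:(0%N)
  | _ :: ?env' => let n := zmod_find x env' in constr:(S n)
  end.
Ltac zmod_vars t env :=
  lazymatch t with
  | (?a + ?b)%R => let env' := zmod_vars a env in zmod_vars b env'
  | (- ?a)%R => zmod_vars a env
  | 0%R => env
  | ?x => match env with
          | _ => let n := zmod_find x env in env
          | _ => constr:(x :: env)
          end
  end.
Ltac zmod_reify t env :=
  lazymatch t with
  | (?a + ?b)%R =>
      let a' := zmod_reify a env in let b' := zmod_reify b env in
      constr:(ZAdd a' b')
  | (- ?a)%R => let a' := zmod_reify a env in constr:(ZOpp a')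
  | 0%R => constr:(ZZero)
  | ?x => let n := zmod_find x env in constr:(ZVar n)
  end.
Ltac zmod :=
  lazymatch goal with
  | |- @eq ?T ?a ?b =>
      let env0 := zmod_vars a (@nil T) in
      let env := zmod_vars b env0 in
      let ea := zmod_reify a env in
      let eb := zmod_reify b env in
      exact: (@zeval_eq _ env ea eb (erefl true))
  end.

(** ** Consequences of the halving property *)

Section ScaleTheory.
Variables (X : topologicalZmodType) (U : nat -> set X).
Hypothesis scaleU : group_scale U.
Implicit Types (x y : X) (n : nat).

Lemma scale_open n : open (U n). Proof. by case: scaleU => -[]. Qed.

Lemma scale0 n : U n 0. Proof. by case: scaleU => -[]. Qed.

Lemma scaleN n x : U n x -> U n (- x).
Proof. by case: scaleU => _ + _ _; apply. Qed.

Lemma scaleD n x y : U n.+1 x -> U n.+1 y -> U n (x + y).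
Proof. by case: scaleU => _ _ + _; apply. Qed.

Lemma scale_base (V : set X) : nbhs 0 V -> exists n, U n `<=` V.
Proof. by case: scaleU => _ _ _; apply. Qed.

Lemma scale_nbhs n : nbhs 0 (U n).
Proof. by apply: open_nbhs_nbhs; split; [apply: scale_open|apply: scale0]. Qed.

Lemma scale_mono n m : (n <= m)%N -> U m `<=` U n.
Proof.
elim: m => [|m IH]; first by rewrite leqn0 => /eqP ->.
rewrite leq_eqVlt => /orP[/eqP -> //|nm] x Ux; apply: IH => //.
by rewrite -[x]addr0; apply: scaleD => //; apply: scale0.
Qed.

Lemma scaleB n x y : U n.+1 x -> U n.+1 y -> U n (x - y).
Proof. by move=> ? /scaleN; apply: scaleD. Qed.

Lemma scale_distC n x y : U n (x - y) -> U n (y - x).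
Proof. by move=> /scaleN; rewrite opprB. Qed.

Lemma scale_tri n x y z : U n.+1 (x - y) -> U n.+1 (y - z) -> U n (x - z).
Proof.
move=> xy yz; have -> : x - z = (x - y) + (y - z) by zmod.
exact: scaleD.
Qed.

Lemma scale_near x (V : set X) n0 : nbhs x V ->
  exists2 n, (n0 <= n)%N & forall y, U n (y - x) -> V y.
Proof.
move=> /nbhs_shift/scale_base[n nV]; exists (maxn n0 n); first exact: leq_maxl.
move=> y /(scale_mono (leq_maxr _ _))/nV /=.
by have -> : x + (y - x) = y by zmod.
Qed.

Lemma scale_cvg (x : nat -> X) (l : X) : x @ \oo --> l ->
  forall k, exists n0, forall n, (n0 <= n)%N -> U k (x n - l).
Proof.
move=> xl k; have [n0 _ n0P] := xl _ (shift_nbhs l (scale_nbhs k)).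
by exists n0 => n n0n; apply: n0P.
Qed.

Lemma scale_separated x y : hausdorff_space X ->
  (forall n, U n (x - y)) -> x = y.
Proof.
move=> hX xy; apply: hX => A B xA yB.
have [n _ nB] := scale_near 0 yB.
by exists x; split; [apply: nbhs_singleton|apply: nB].
Qed.

(** Klee's argument. A subsequence of x is written as the difference of two
    sequences, y and y + x o n, each of which converges for the given complete
    metric. Stage k fixes the point w = y + x m first, then a small
    neighbourhood of w, and only then an index n' so large that x stays within
    that neighbourhood; replacing y by w - x n' keeps y + x n' equal to w while
    moving y by the small amount x m - x n'. *)
Lemma cauchy_converges (R : realType) : completely_metrizable R X ->
  forall x : nat -> X,
    (forall k, exists n0, forall m n, (n0 <= m)%N -> (n0 <= n)%N ->
       U k (x m - x n)) ->
  exists l, forall k, exists n0, forall n, (n0 <= n)%N -> U k (x n - l).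
Proof.
move=> /completely_metrizable_balls[N [N0 _ Ncvg]] x xC.
(* a state (y, n, j, l) carries a neighbourhood of scale j around y and one of
   scale l around y + x n *)
pose good k (s : X * nat * nat * nat) := let: (y, n, j, l) := s in
  [/\ forall z, U j (z - y) -> N k y z,
      forall z, U l (z - (y + x n)) -> N k (y + x n) z &
      forall i i', (n <= i)%N -> (n <= i')%N -> U l.+1 (x i - x i')].
pose next (s s' : X * nat * nat * nat) := let: (y, n, j, l) := s in
  let: (y', n', j', l') := s' in
  [/\ (n < n')%N, forall z, U j' (z - y') -> U j (z - y) &
      forall z, U l' (z - (y' + x n')) -> U l (z - (y + x n))].
have init : exists s, good 0%N s.
  have [n0 n0P] := xC 1%N.
  have [j _ jP] := scale_near 0 (N0 0%N 0).
  have [l _ lP] := scale_near 0 (N0 0%N (0 + x n0)).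
  have [n nP] := xC l.+1.
  pose m := maxn n n0.
  have [j' _ j'P] := scale_near 0 (N0 0%N (x n0 - x m)).
  exists (x n0 - x m, m, j', l); split => //.
    have -> : x n0 - x m + x m = 0 + x n0 by zmod.
    exact: lP.
  by move=> i i' mi mi'; apply: nP; rewrite (leq_trans _ mi, leq_trans _ mi')// leq_maxl.
have step k s : exists s', good k s -> good k.+1 s' /\ next s s'.
  case: s => [[[y n] j] l].
  have [[jP lP nP]|] := pselect (good k (y, n, j, l)); last by exists (y, n, j, l).
  have [m0 m0P] := xC j.+1; pose m := maxn n m0.
  pose w := y + x m.
  have [l' ll' l'P] := scale_near l.+1 (N0 k.+1 w).
  have [n0 n0P] := xC l'.+1; pose n' := maxn m.+1 n0.
  have mn' : (m < n')%N by rewrite leq_maxl.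
  have nm : (n <= m)%N by rewrite leq_maxl.
  pose y' := y + x m - x n'.
  have [j' jj' j'P] := scale_near j.+1 (N0 k.+1 y').
  have y'x : y' + x n' = w by rewrite /y' /w; zmod.
  exists (y', n', j', l') => _; split; split; rewrite ?y'x//.
  - move=> i i' ni ni'; apply: n0P; [apply: leq_trans ni|apply: leq_trans ni'];
      exact: leq_maxr.
  - exact: leq_ltn_trans mn'.
  - move=> z zy'; apply: (@scale_tri _ _ y'); first exact: scale_mono zy'.
    have -> : y' - y = x m - x n' by rewrite /y'; zmod.
    apply: m0P; first exact: leq_maxr.
    by apply: leq_trans (ltnW mn'); apply: leq_maxr.
  - move=> z zw; apply: (@scale_tri _ _ w); first exact: scale_mono zw.
    have -> : w - (y + x n) = x m - x n by rewrite /w; zmod.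
    exact: nP.
have step' (ks : nat * (X * nat * nat * nat)) :
    exists s', good ks.1 ks.2 -> good ks.1.+1 s' /\ next ks.2 s'.
  exact: step.
have [F FP] := choice step'; have [s0 s0P] := init.
pose S := fix S k := if k is k'.+1 then F (k', S k') else s0.
have Sgood k : good k (S k).
  by elim: k => // k IH; have [] := FP (k, S k) IH.
have Snext k : next (S k) (S k.+1) by have [] := FP (k, S k) (Sgood k).
pose y k := (S k).1.1.1; pose n k := (S k).1.1.2.
have n_ge k : (k <= n k)%N.
  elim: k => // k IH; move: (Snext k); rewrite /n /next in IH *.
  by case: (S k) (S k.+1) IH => [[[? ?] ?] ?] [[[? ?] ?] ?] /= IH [/(leq_ltn_trans IH)].
have Sy k d : forall z, U (S (k + d)%N).1.2 (z - y (k + d)%N) -> U (S k).1.2 (z - y k).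
  elim: d => [|d IH] z; first by rewrite addn0.
  rewrite addnS => h; apply: IH; move: (Snext (k + d)%N) h; rewrite /next /y.
  case: (S (k + d)%N) (S (k + d).+1) => [[[? ?] ?] ?] [[[? ?] ?] ?] /= [_ + _].
  exact.
have Sw k d : forall z, U (S (k + d)%N).2 (z - (y (k + d)%N + x (n (k + d)%N))) ->
    U (S k).2 (z - (y k + x (n k))).
  elim: d => [|d IH] z; first by rewrite addn0.
  rewrite addnS => h; apply: IH; move: (Snext (k + d)%N) h; rewrite /next /y /n.
  case: (S (k + d)%N) (S (k + d).+1) => [[[? ?] ?] ?] [[[? ?] ?] ?] /= [_ _ +].
  exact.
have [a ya] : exists a : X, y @ \oo --> a.
  apply: Ncvg => k m km; move: (Sgood k) (Sy k (m - k)%N (y m)).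
  rewrite subnKC// subrr /good /y; case: (S k) => [[[? ?] ?] ?] /= [yN _ _] h.
  by apply: yN; apply: h; apply: scale0.
have [b wb] : exists b : X, (fun k => y k + x (n k)) @ \oo --> b.
  apply: Ncvg => k m km; move: (Sgood k) (Sw k (m - k)%N (y m + x (n m))).
  rewrite subnKC// subrr /good /y /n; case: (S k) => [[[? ?] ?] ?] /= [_ wN _] h.
  by apply: wN; apply: h; apply: scale0.
exists (b - a) => k.
have [n1 n1P] := scale_cvg ya k.+2; have [n2 n2P] := scale_cvg wb k.+2.
have [n3 n3P] := xC k.+1.
exists n3 => i n3i; pose m := maxn n1 (maxn n2 n3).
apply: (@scale_tri _ _ (x (n m))).
  by apply: n3P => //; apply: leq_trans (n_ge _); rewrite !leq_max leqnn !orbT.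
have -> : x (n m) - (b - a) = (y m + x (n m) - b) - (y m - a) by zmod.
by apply: scaleB; [apply: n2P|apply: n1P]; rewrite !leq_max leqnn ?orbT.
Qed.

End ScaleTheory.

(** * Failure of local compactness *)

Lemma ultra_cover (T : choiceType) (F : set_system T) (C : T -> set T) (l : seq T) :
  UltraFilter F -> F [set a | exists2 b, b \in l & C b a] ->
  exists b, F (C b).
Proof.
move=> FU; elim: l => [|c l IH] Fl.
  by have [x [b]] := @filter_ex _ F _ _ Fl.
have [Fc|FNc] := in_ultra_setVsetC (C c) FU; first by exists c.
apply: IH; apply: filterS (filterI Fl FNc) => a [[b]].
rewrite inE => /predU1P[->|bl] Cba nCca; first by have := nCca Cba.
by exists b.
Qed.

Section NonLocallyCompact.
Variables (R : realType) (X : topologicalZmodType) (U : nat -> set X).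
Hypotheses (scaleU : group_scale U) (Xcm : completely_metrizable R X).

(** An ultrafilter on a totally bounded set contains a translate of each member
    of the scale; the centres of these translates form a Cauchy sequence, whose
    limit is the limit of the ultrafilter. *)
Lemma totally_bounded_compact n :
  (forall m, exists l : seq X, forall a, U n a -> exists2 b, b \in l & U m (a - b)) ->
  compact (closure (U n.+1)).
Proof.
move=> tb; rewrite compact_ultra => F FU FA.
have sub : closure (U n.+1) `<=` U n.
  move=> x /(_ _ (shift_nbhs x (scale_nbhs scaleU n.+1)))[y [Uy yx]].
  have -> : x = y - (y - x) by zmod.
  by apply: (scaleB scaleU).
have exb m : exists b, F [set a | U m (a - b)].
  have [l lP] := tb m.
  apply: (@ultra_cover _ F (fun b => [set a | U m (a - b)]) l).
  by apply: filterS FA => a /sub; apply: lP.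
have [b bP] := choice exb.
have [|l lP] := cauchy_converges scaleU Xcm (x := b).
  move=> k; exists k.+1 => m m' km km'.
  have [a [am am']] := @filter_ex _ F _ _ (filterI (bP m) (bP m')).
  apply: (scale_tri scaleU (y := a)); last exact: (scale_mono scaleU km').
  by apply: (scale_distC scaleU); apply: (scale_mono scaleU km).
have Fl : F --> l.
  move=> V lV; have [k _ kV] := scale_near scaleU 0 lV.
  have [n0 n0P] := lP k.+1; pose m := maxn n0 k.+1.
  apply: (filterS _ (bP m)) => a am; apply: kV.
  apply: (scale_tri scaleU (y := b m)); last by apply: n0P; rewrite leq_maxl.
  by apply: (scale_mono scaleU _ am); rewrite leq_maxr.
exists l; split => //.
rewrite closureE => B [cB UB]; apply: (@closed_cvg _ _ F _ id B cB _ l Fl).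
by apply: filterS FA => a; rewrite closureE; apply.
Qed.

Lemma scale_not_totally_bounded : ~ locally_compact [set: X] ->
  forall n, exists m, forall l : seq X,
    exists2 a, U n a & forall b, b \in l -> ~ U m (a - b).
Proof.
move=> nlc n; apply: contrapT => /forallNP tb; apply: nlc => x _.
have cU : compact (closure (U n.+1)).
  apply: totally_bounded_compact => m.
  have /existsNP[l lP] := tb m; exists l => a Ua; apply: contrapT => nb.
  apply: lP; exists a => // b bl Umab; apply: nb; by exists b.
have cx : continuous (fun y => x + y).
  move=> y.
  apply: (@continuous_comp _ _ _ (fun y : X => (x, y)) (fun z : X * X => z.1 + z.2)).
    by apply: cvg_pair => /=; [exact: cvg_cst|exact: cvg_id].
  exact: add_continuous.
exists [set x + y | y in closure (U n.+1)].
  apply: filterS (shift_nbhs x (scale_nbhs scaleU n.+1)) => y Uy _.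
  by exists (y - x); [exact: subset_closure|zmod].
have cK : compact [set x + y | y in closure (U n.+1)].
  by apply: continuous_compact => //; apply: continuous_subspaceT.
split=> //; apply: compact_closed => //.
exact: completely_metrizable_hausdorff Xcm.
Qed.

End NonLocallyCompact.

(** The quantitative form of the failure of local compactness: no W n is covered
    by finitely many translates of W n.+1. *)
Lemma spread_scale_exists (R : realType) (X : topologicalZmodType) :
    completely_metrizable R X -> ~ locally_compact [set: X] ->
  exists2 W : nat -> set X, group_scale W &
    forall n (l : seq X), exists2 a, W n a & forall b, b \in l -> ~ W n.+1 (a - b).
Proof.
move=> Xcm nlc; have [U sU] := group_scale_exists Xcm.
have exm := scale_not_totally_bounded sU Xcm nlc.
have [|phi sphi phiP] := group_scale_subseq sU exm.
  move=> n m m' mm' mP l; have [a Ua aP] := mP l; exists a => // b bl.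
  by move=> /(scale_mono sU mm'); apply: aP.
by exists (U \o phi) => // n l; have := phiP n l.
Qed.

(** * Spreading by translations *)

(** The n-th term of a series lies in W (6 * n). Six halvings per step leave room
    for the tail of the series and for the few sums and differences that the
    separation argument takes inside one step. *)
Section Series.
Variables (R : realType) (X : topologicalZmodType) (W : nat -> set X).
Hypotheses (scaleW : group_scale W) (Xcm : completely_metrizable R X).

Lemma scale_sum (b : nat -> X) : (forall n, W (6 * n.+1)%N (b n.+1)) ->
  forall d n, W (6 * n + 5)%N (\sum_(i < d) b (n.+1 + i)%N).
Proof.
move=> bW; elim=> [|d IH] n; first by rewrite big_ord0; apply: (scale0 scaleW).
rewrite big_ord_recl addn0; apply: (scaleD scaleW).
  by rewrite -addnS -mulnSr; apply: bW.
apply: (scale_mono scaleW (m := 6 * n.+1 + 5)%N); first by lia.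
under eq_bigr => i _ do rewrite /= /bump /= add1n addnS -addSn.
exact: IH.
Qed.

Lemma scale_series (b : nat -> X) : (forall n, W (6 * n.+1)%N (b n.+1)) ->
  exists s, forall n, W (6 * n + 4)%N (s - \sum_(i < n.+1) b i).
Proof.
move=> bW; pose P n := \sum_(i < n.+1) b i.
have PW n m : (n <= m)%N -> W (6 * n + 5)%N (P m - P n).
  move=> nm; have -> : P m - P n = \sum_(i < m - n) b (n.+1 + i)%N.
    rewrite /P -!(big_mkord xpredT) (@big_cat_nat _ _ _ n.+1)//= ?ltnS//.
    rewrite addrAC subrr add0r -{1}(add0n n.+1) big_addn subSS.
    by rewrite big_mkord; apply: eq_bigr => i _; rewrite addnC.
  exact: scale_sum.
have [|s sP] := cauchy_converges scaleW Xcm (x := P).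
  move=> k; exists k => m m' km km'.
  apply: (scale_mono scaleW (m := 6 * k + 4)%N); first by lia.
  apply: (scale_tri scaleW (y := P k)); first by rewrite -addnS; apply: PW.
  by apply: (scale_distC scaleW); rewrite -addnS; apply: PW.
exists s => n; have [n0 n0P] := sP (6 * n + 5)%N.
have -> : s - \sum_(i < n.+1) b i =
    (P (maxn n0 n) - P n) - (P (maxn n0 n) - s) by rewrite /P; zmod.
apply: (scaleB scaleW); first by rewrite -addnS; apply: PW; apply: leq_maxr.
by rewrite -addnS; apply: n0P; apply: leq_maxl.
Qed.

End Series.

Section Spread.
Variables (R : realType) (X : topologicalZmodType) (W : nat -> set X).
Hypotheses (scaleW : group_scale W) (Xcm : completely_metrizable R X).
Hypothesis spreadW : forall n (l : seq X),
  exists2 a, W n a & forall b, b \in l -> ~ W n.+1 (a - b).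

(** Each term has to avoid finitely many translates of W n.+1, determined by the
    earlier terms, which is possible since these translates do not cover W n. *)
Lemma spread_sequence n (F : nat -> nat -> X -> seq X) :
  exists2 b : nat -> X, forall k, W n (b k) &
    forall j k, (j < k)%N -> forall y, y \in F j k (b j) -> ~ W n.+1 (b k - y).
Proof.
have exA (l : seq X) : exists a, W n a /\ forall b, b \in l -> ~ W n.+1 (a - b).
  by have [a] := spreadW n l; exists a.
have [A AP] := choice exA.
pose G k (l : seq X) := A (flatten [seq F j k (nth 0 l j) | j <- iota 0 k]).
pose L := fix L k := if k is k'.+1 then rcons (L k') (G k' (L k')) else [::].
have sL k : size (L k) = k by elim: k => //= k; rewrite size_rcons => ->.
pose b k := G k (L k).
have nL k j : (j < k)%N -> nth 0 (L k) j = b j.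
  elim: k => // k IH; rewrite ltnS leq_eqVlt /= nth_rcons sL.
  by case/predU1P=> [->|jk]; rewrite ?ltnn ?eqxx// jk IH.
have bP k := AP (flatten [seq F j k (nth 0 (L k) j) | j <- iota 0 k]).
exists b => [k|j k jk y yF]; first by have [] := bP k.
have [_] := bP k; apply.
apply/flatten_mapP; exists j; first by rewrite mem_iota.
by rewrite nL.
Qed.

Variables (Q : seq nat -> seq X) (D : nat -> seq X).

(** One step of the construction of the translations: the partial sums T are
    extended by terms a(s) for all finite sequences s at once, in the order of
    their codes. Being an enumeration in type omega, this order makes every s
    avoid only finitely many predecessors. *)
Lemma spread_level n (T : seq nat -> X) : exists a : seq nat -> X,
  (forall s, W (6 * n)%N (a s)) /\
  forall s s', s != s' -> forall q q' r, q \in Q s -> q' \in Q s' -> r \in D n ->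
    ~ W (6 * n).+1 ((q + (T s + a s)) - (q' + (T s' + a s')) - r).
Proof.
pose dec k : seq nat := odflt [::] (unpickle k).
pose dif q q' r s' s y : X := q' + (T s' + y) + r - q - T s.
pose F j k y := [seq dif q qr.1 qr.2 (dec j) (dec k) y |
  q <- Q (dec k), qr <- [seq (q', r) | q' <- Q (dec j), r <- D n ++ map -%R (D n)]].
have [b bW bF] := spread_sequence (6 * n)%N F.
exists (b \o pickle); split=> [s|s s' ss' q q' r qs qs' rD]; first exact: bW.
have avoid s1 s2 q1 q2 r0 : (pickle s1 < pickle s2)%N ->
    q1 \in Q s1 -> q2 \in Q s2 -> r0 \in D n ++ map -%R (D n) ->
    ~ W (6 * n).+1 ((q2 + (T s2 + b (pickle s2))) - (q1 + (T s1 + b (pickle s1))) - r0).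
  move=> lt12 q1s q2s r0D.
  have := bF _ _ lt12 (dif q2 q1 r0 s1 s2 (b (pickle s1))).
  have -> : b (pickle s2) - dif q2 q1 r0 s1 s2 (b (pickle s1)) =
    q2 + (T s2 + b (pickle s2)) - (q1 + (T s1 + b (pickle s1))) - r0.
    by rewrite /dif; zmod.
  apply; rewrite /F /dec !pickleK /=.
  apply: (allpairs_f (fun q qr => dif q qr.1 qr.2 s1 s2 (b (pickle s1)))
    (y := (q1, r0))) => //.
  exact: (allpairs_f (fun q r => (q, r))).
have [lt|lt|/(pcan_inj pickleK)/eqP] := ltngtP (pickle s) (pickle s').
- have rD' : - r \in D n ++ map -%R (D n) by rewrite mem_cat map_f ?orbT.
  have oppE x y : - (x - y - r) = y - x - (- r) by zmod.
  by move=> /(scaleN scaleW); rewrite oppE; apply: avoid.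
- by apply: avoid => //; rewrite mem_cat rD.
- by rewrite (negPf ss').
Qed.

(** The translation t(p) is the sum of a series whose n-th term depends on the
    first n+1 values of p. When the finite sets Q s approximate compact sets,
    the n-th term separates the pieces with different initial segments, even up
    to the finite set D n of displacements. *)
Lemma spread_translations :
  exists (T : nat -> seq nat -> X) (t : (nat -> nat) -> X),
  (forall p n, W (6 * n + 4)%N (t p - T n (mkseq p n.+1))) /\
  forall n s s', s != s' ->
    forall q q' r, q \in Q s -> q' \in Q s' -> r \in D n ->
    ~ W (6 * n).+1 ((q + T n s) - (q' + T n s') - r).
Proof.
have exa (nT : nat * (seq nat -> X)) := spread_level nT.1 nT.2.
have [a aP] := choice exa.
pose T := fix T n s :=
  if n is m.+1 then T m (take m s) + a (m, T m \o take m) s else 0.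
pose b p n := a (n, T n \o take n) (mkseq p n.+1).
have bW p n : W (6 * n.+1)%N (b p n.+1).
  by have [aW _] := aP (n.+1, T n.+1 \o take n.+1); apply: aW.
have take_mkseq p n : take n (mkseq p n.+1) = mkseq p n.
  by rewrite /mkseq -map_take take_iota (minn_idPl (leqnSn n)).
have TE p n : T n (mkseq p n) = \sum_(i < n) b p i.
  by elim: n => [|n IH]; rewrite ?big_ord0// big_ord_recr /= take_mkseq IH.
have [t tP] := choice (fun p => scale_series scaleW Xcm (bW p)).
exists (fun n => T n.+1), t; split=> [p n|n s s' ss' q q' r qs qs' rD].
  by rewrite TE.
by have [_] := aP (n, T n \o take n); apply.
Qed.

End Spread.

(** * Codes for continuous maps on the Cantor space *)

Lemma cylinder_nbhs (z : cantor_space) n :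
  nbhs z [set z' : cantor_space | mkseq z' n = mkseq z n].
Proof.
have zi i : nbhs z [set z' : cantor_space | z' i = z i].
  have /= c := @proj_continuous nat (fun=> bool) i z.
  exact: c (discrete_set1 (z i)).
elim: n => [|n IH]; first by apply: filterS filterT.
apply: filterS (filterI IH (zi n)) => z' [e en].
by rewrite /= !mkseqS e en.
Qed.

(** Otherwise points outside V that agree with z on longer and longer initial
    segments would converge to z. *)
Lemma nbhs_cylinder (z : cantor_space) (V : set cantor_space) : nbhs z V ->
  exists n, forall z' : cantor_space, mkseq z' n = mkseq z n -> V z'.
Proof.
move=> zV; apply: contrapT => /forallNP H.
have ex n : exists z' : cantor_space, mkseq z' n = mkseq z n /\ ~ V z'.
  by have /existsNP[z' /not_implyP] := H n; exists z'.
have [y yP] := choice ex.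
have yz : y @ \oo --> z.
  apply/cvg_sup => i A [B] [[C] oC <-] CzN BA.
  apply: (filterS BA); rewrite nbhs_simpl; exists i.+1 => // n /= ni.
  suff -> : y n i = z i by [].
  have [/(congr1 (fun s => nth false s i)) + _] := yP n.
  by rewrite !nth_mkseq.
have [n0 _ /(_ n0 (leqnn _))] := yz _ zV.
by have [] := yP n0.
Qed.

Lemma mkseq_le (T : Type) (f g : nat -> T) n m :
  (n <= m)%N -> mkseq f m = mkseq g m -> mkseq f n = mkseq g n.
Proof.
move=> nm /(congr1 (take n)).
by rewrite /mkseq -!map_take !take_iota (minn_idPl nm).
Qed.

Section LocallyConstant.
Variables (R : realType) (X : topologicalZmodType) (W : nat -> set X).
Hypotheses (scaleW : group_scale W) (Xcm : completely_metrizable R X).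

Lemma cantor_uniform_continuity (f : cantor_space -> X) n : continuous f ->
  exists N, forall z z' : cantor_space, mkseq z N = mkseq z' N -> W n (f z - f z').
Proof.
move=> cf; apply: contrapT => /forallNP H.
have ex N : exists zz : cantor_space * cantor_space,
    mkseq zz.1 N = mkseq zz.2 N /\ ~ W n (f zz.1 - f zz.2).
  by have /existsNP[z /existsNP[z' /not_implyP]] := H N; exists (z, z').
have [y yP] := choice ex.
have PF : ProperFilter (fst \o y @ \oo) by apply: fmap_proper_filter.
have [z [_ zy]] := cantor_space_compact PF filterT.
have zV : nbhs z [set z' | W n.+1 (f z' - f z)].
  exact: cf z _ (shift_nbhs (f z) (scale_nbhs scaleW n.+1)).
have [m mV] := nbhs_cylinder zV.
have [||_ [/= [N mN <-] /= yz]] :=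
    zy [set (y N).1 | N in [set N | (m <= N)%N]] [set z' | mkseq z' m = mkseq z m].
- by exists m => // N /= mN; exists N.
- exact: cylinder_nbhs.
have [yN []] := yP N.
apply: (scale_tri scaleW (y := f z)); first exact: mV.
apply: (scale_distC scaleW); apply: mV.
by rewrite -yz; apply: mkseq_le mN _.
Qed.

Variable d : nat -> X.
Hypothesis d_dense : forall n x, exists i, W n (x - d i).

(** A natural number codes a value to be passed on, a depth N, and a list of
    indices of points of the dense sequence d. *)
Definition parse_code (k : nat) : nat * (nat * seq nat) :=
  odflt (0%N, (0%N, [::])) (unpickle k).

(** For positive n, the list is discarded if some entry is not in W (6 * n): in
    this way every coded series converges. *)
Definition table n k : seq X :=
  let l := map d (parse_code k).2.2 in
  if (n == 0%N) || `[< forall x, x \in l -> W (6 * n)%N x >] then l else [::].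

(** The locally constant map coded by k looks up the first N bits of z in the
    table. *)
Definition locconst n k (z : cantor_space) : X :=
  nth 0 (table n k) (pickle (mkseq z (parse_code k).2.1)).

Lemma locconst_table n k z : locconst n k z \in 0 :: table n k.
Proof.
rewrite /locconst inE.
have [lt|ge] := ltnP (pickle (mkseq z (parse_code k).2.1)) (size (table n k)).
  by rewrite mem_nth ?orbT.
by rewrite nth_default ?eqxx.
Qed.

Lemma locconst_small n k z : W (6 * n.+1)%N (locconst n.+1 k z).
Proof.
have /predU1P[->|] := locconst_table n.+1 k z; first exact: (scale0 scaleW).
by rewrite /table /=; case: asboolP => // + lt; apply.
Qed.

Lemma locconst_continuous n k : continuous (locconst n k).
Proof.
move=> z V lV; apply: filterS (cylinder_nbhs z (parse_code k).2.1) => z' zz'.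
by rewrite /preimage /= /locconst zz'; apply: nbhs_singleton.
Qed.

Lemma locconst_approx n c (f : cantor_space -> X) : continuous f ->
    (n != 0%N -> forall z, W (6 * n + 1)%N (f z)) ->
  exists k, (parse_code k).1 = c /\ forall z, W (6 * n + 7)%N (f z - locconst n k z).
Proof.
move=> cf fW; have [N NP] := cantor_uniform_continuity (6 * n + 8)%N cf.
pose ext (w : seq bool) : cantor_space := nth false w.
have [i iP] := choice (fun w => d_dense (6 * n + 8)%N (f (ext w))).
pose M := (\max_(w : N.-tuple bool) pickle (tval w)).+1.
pose l := mkseq (fun m => i (odflt [::] (unpickle m))) M.
have ld x : x \in map d l -> n != 0%N -> W (6 * n)%N x.
  move=> /mapP[j /mapP[m _ ->] ->] n0.
  set w := odflt _ _; have -> : d (i w) = f (ext w) - (f (ext w) - d (i w)) by zmod.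
  apply: (scaleB scaleW); first by rewrite -addn1; apply: fW.
  by apply: (scale_mono scaleW _ (iP w)); lia.
have lN (z : cantor_space) : (pickle (mkseq z N) < size l)%N /\
    nth 0%N l (pickle (mkseq z N)) = i (mkseq z N).
  have zM : (pickle (mkseq z N) < M)%N.
    have zN : size (mkseq z N) == N by rewrite size_mkseq.
    by rewrite ltnS; apply: (leq_bigmax (Tuple zN)).
  by rewrite size_mkseq nth_mkseq// pickleK.
clearbody l.
exists (pickle (c, (N, l))).
have pE : parse_code (pickle (c, (N, l))) = (c, (N, l)) by rewrite /parse_code pickleK.
split=> [|z]; first by rewrite pE.
have tE : table n (pickle (c, (N, l))) = map d l.
  rewrite /table pE /=; case: eqP => //= /eqP n0; case: asboolP => //= -[] x xl.
  exact: ld.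
have [lz lnth] := lN z.
rewrite /locconst tE pE /= (nth_map 0%N)// lnth.
have -> : (6 * n + 7)%N = (6 * n + 6).+1 by rewrite addnS.
apply: (scale_tri scaleW (y := f (ext (mkseq z N)))); rewrite -!addnS; last exact: iP.
apply: NP; apply/(@eq_from_nth _ false); rewrite !size_mkseq// => j jN.
by rewrite !nth_mkseq// /ext nth_mkseq.
Qed.

(** Every continuous map is the sum of a coded series: approximate it by a
    locally constant map, then approximate the remainder, and so on. The values
    c n are carried along by the same code. *)
Lemma locconst_expansion (f : cantor_space -> X) (c : nat -> nat) :
  continuous f -> exists p : nat -> nat,
    (forall n, (parse_code (p n)).1 = c n) /\
    forall n z, W (6 * n + 7)%N (f z - \sum_(i < n.+1) locconst i (p i) z).
Proof.
move=> cf.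
pose ok n (g : cantor_space -> X) :=
  continuous g /\ (n != 0%N -> forall z, W (6 * n + 1)%N (g z)).
have ex (ng : nat * (cantor_space -> X)) : exists k, ok ng.1 ng.2 ->
    (parse_code k).1 = c ng.1 /\
    forall z, W (6 * ng.1 + 7)%N (ng.2 z - locconst ng.1 k z).
  have [[g1 g2]|] := pselect (ok ng.1 ng.2); last by exists 0%N.
  by have [k kP] := locconst_approx (c ng.1) g1 g2; exists k.
have [K KP] := choice ex.
pose g := fix g n : cantor_space -> X :=
  if n is m.+1 then (fun z => g m z - locconst m (K (m, g m)) z) else f.
have gok n : ok n (g n).
  elim: n => [|n IH]; first by split.
  split=> [z|_ z]; last by have [_ /(_ z)] := KP (n, g n) IH; rewrite mulnSr -addnA.
  apply: (@continuous_comp _ _ _ (fun z => (g n z, locconst n (K (n, g n)) z))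
    (fun y : X * X => y.1 - y.2)); last exact: sub_continuous.
  by apply: cvg_pair; [case: IH => + _; apply|apply: locconst_continuous].
pose p n := K (n, g n).
have gS n z : g n.+1 z = g n z - locconst n (p n) z by [].
have gE n z : g n z = f z - \sum_(i < n) locconst i (p i) z.
  elim: n => [|n IH]; first by rewrite big_ord0 subr0.
  rewrite gS IH big_ord_recr /=.
  by rewrite opprD addrA.
exists p; split=> [n|n z]; first by have [] := KP (n, g n) (gok n).
rewrite -gE; have [_ /(_ isT z)] := gok n.+1.
by rewrite mulnSr -addnA.
Qed.

Lemma locconst_sum : exists ev : (nat -> nat) -> cantor_space -> X,
  forall p z n, W (6 * n + 4)%N (ev p z - \sum_(i < n.+1) locconst i (p i) z).
Proof.
have ex (pz : (nat -> nat) * cantor_space) :=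
  scale_series scaleW Xcm (b := fun i => locconst i (pz.1 i) pz.2)
    (fun n => locconst_small n (pz.1 n.+1) pz.2).
have [ev evP] := choice ex.
by exists (fun p z => ev (p, z)) => p z n; apply: evP (p, z) n.
Qed.

(** The finitely many values that the first n terms of the series coded by s can
    add up to. *)
Fixpoint table_sums n (s : seq nat) : seq X :=
  if n is m.+1 then [seq x + y | x <- table_sums m s, y <- 0 :: table m (nth 0%N s m)]
  else [:: 0].

Lemma table_sums0 n s : 0 \in table_sums n s.
Proof.
elim: n => [|n IH]; first by rewrite mem_head.
by rewrite -[0]addr0; apply: (allpairs_f +%R); rewrite ?mem_head.
Qed.

Lemma locconst_table_sums n s z :
  \sum_(i < n) locconst i (nth 0%N s i) z \in table_sums n s.
Proof.
elim: n => [|n IH]; first by rewrite big_ord0 mem_head.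
by rewrite big_ord_recr; apply: (allpairs_f +%R); last exact: locconst_table.
Qed.

End LocallyConstant.

(** * Sigma-algebras and Borel uniformization *)

Section SigmaAlgebra.
Variables (T : Type) (S : set (set T)).
Hypothesis salgS : sigma_algebra setT S.

Lemma salg_not (P : T -> Prop) : S [set x | P x] -> S [set x | ~ P x].
Proof.
case: salgS => _ SC _ /SC; congr (S _).
by apply/seteqP; split=> x /=; [case|split].
Qed.

Lemma salg_exists (K : countType) (P : K -> T -> Prop) :
  (forall k, S [set x | P k x]) -> S [set x | exists k, P k x].
Proof.
case: salgS => S0 _ SU SP.
have := SU (fun n => if unpickle n is Some k then [set x | P k x] else set0).
have -> : \bigcup_n (if unpickle n is Some k then [set x | P k x] else set0) =
    [set x | exists k, P k x].
  apply/seteqP; split=> [x [n _]|x [k Pk]].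
    by case: (unpickle n) => // k Pk; exists k.
  by exists (pickle k) => //; rewrite pickleK.
by apply=> n; case: unpickle.
Qed.

Lemma salg_forall (K : countType) (P : K -> T -> Prop) :
  (forall k, S [set x | P k x]) -> S [set x | forall k, P k x].
Proof.
move=> SP.
have -> : [set x | forall k, P k x] = [set x | ~ exists k, ~ P k x].
  by apply/seteqP; split=> x /= => [Px [k]|/forallNP Px k]; [exact|apply: contrapT].
by apply: salg_not; apply: salg_exists => k; apply: salg_not.
Qed.

Lemma salg_const (P : Prop) : S [set x | P].
Proof.
case: salgS => S0 _ _; have [p|np] := pselect P.
  have -> : [set x | P] = [set x : T | ~ set0 x] by apply/seteqP; split=> x _ // [].
  exact: salg_not.
by have -> : [set x | P] = set0 :> set T by apply/seteqP; split=> x.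
Qed.

Lemma salg_and (P Q : T -> Prop) :
  S [set x | P x] -> S [set x | Q x] -> S [set x | P x /\ Q x].
Proof.
move=> SP SQ.
have -> : [set x | P x /\ Q x] = [set x | forall b : bool, if b then P x else Q x].
  apply/seteqP; split=> x /= => [[Px Qx] []//|h].
  by split; [apply: (h true)|apply: (h false)].
by apply: salg_forall => -[].
Qed.

Lemma salg_imply (P Q : T -> Prop) :
  S [set x | P x] -> S [set x | Q x] -> S [set x | P x -> Q x].
Proof.
move=> SP SQ.
have -> : [set x | P x -> Q x] = [set x | ~ (P x /\ ~ Q x)].
  apply/seteqP; split=> x /= => [PQ [/PQ//]|n Px].
  by apply: contrapT => nQ; apply: n.
by apply: salg_not; apply: salg_and => //; apply: salg_not.
Qed.

(** The space splits into the countably many fibres of c, and on each of them P is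
    applied to a constant. *)
Lemma salg_countable_valued (K : countType) (c : T -> K) (P : K -> T -> Prop) :
  (forall k, S [set x | c x = k]) -> (forall k, S [set x | P k x]) ->
  S [set x | P (c x) x].
Proof.
move=> Sc SP.
have -> : [set x | P (c x) x] = [set x | exists k, c x = k /\ P k x].
  by apply/seteqP; split=> x /= => [Px|[k [<-]]//]; exists (c x).
by apply: salg_exists => k; apply: salg_and.
Qed.

Lemma salg_mkseq (K : countType) (c : T -> nat -> K) n s :
  (forall i k, S [set x | c x i = k]) -> S [set x | mkseq (c x) n = s].
Proof.
move=> Sc; elim: n s => [|n IH] s; first exact: (salg_const ([::] = s)).
have -> : [set x | mkseq (c x) n.+1 = s] =
   [set x | exists t, mkseq (c x) n = t /\ exists k, c x n = k /\ rcons t k = s].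
  apply/seteqP; split=> x /=; rewrite mkseqS; last by case=> t [-> [k [->]]].
  by move=> <-; exists (mkseq (c x) n); split=> //; exists (c x n).
apply: salg_exists => t; apply: salg_and => //; apply: salg_exists => k.
by apply: salg_and => //; apply: salg_const.
Qed.

Lemma sigma_algebra_preimage (U : Type) (f : T -> U) :
  sigma_algebra setT [set A : set U | S (f @^-1` A)].
Proof.
split=> [|A /= SA|F SF] /=.
- by rewrite preimage_set0; case: salgS.
- by rewrite setTD preimage_setC; apply: salg_not.
- by rewrite preimage_bigcup; case: salgS => _ _; apply.
Qed.

Lemma borel_preimage (U : topologicalType) (f : T -> U) :
  (forall O, open O -> S (f @^-1` O)) -> forall B, borel B -> S (f @^-1` B).
Proof.
move=> Sf; apply: smallest_sub; first exact: sigma_algebra_preimage.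
by move=> O /= /Sf.
Qed.

End SigmaAlgebra.

Lemma borel_sigma_algebra (T : topologicalType) : sigma_algebra setT (@borel T).
Proof. exact: smallest_sigma_algebra. Qed.

Lemma borel_open (T : topologicalType) (A : set T) : open A -> borel A.
Proof. by move=> oA; apply: sub_sigma_algebra. Qed.

Section Uniformization.
Variable Y : topologicalType.
Implicit Type B : set (cantor_space * Y).

Lemma borel_coordinate n : borel [set x : cantor_space * Y | x.1 n].
Proof.
have cf : continuous (@fst cantor_space Y) by move=> x; apply: cvg_fst.
apply: borel_open; move/continuousP: cf => /(_ [set z | z n]); apply.
rewrite openE => z zn; apply: filterS (cylinder_nbhs z n.+1) => z' /=.
move=> /(congr1 (nth false ^~ n)).
by rewrite !nth_mkseq// => ->.
Qed.

Lemma borel_snd (C : set Y) :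
  borel C -> borel [set x : cantor_space * Y | C x.2].
Proof.
apply: (borel_preimage (borel_sigma_algebra _) (f := snd)) => O oO.
have cf : continuous (@snd cantor_space Y) by move=> x; apply: cvg_snd.
by apply: borel_open; move/continuousP: cf; apply.
Qed.

(** A Luzin scheme for B is a sequence of countable Borel covers of B such that,
    for each y, a choice of one member of every cover leads to points of B only:
    if z is a limit of points z' that belong to B and to the first n chosen sets
    (over y), then z belongs to B over y. Such schemes replace the
    representation of a Borel set as an injective continuous image of a closed
    set. *)
Definition luzin B : Prop := exists D : nat -> nat -> set (cantor_space * Y),
  [/\ forall n k, borel (D n k), forall n x, B x -> exists k, D n k x &
      forall (sg : nat -> nat) (z : cantor_space) y,
        (forall n, exists z' : cantor_space, [/\ B (z', y),
           forall i, (i < n)%N -> D i (sg i) (z', y) & mkseq z' n = mkseq z n]) ->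
        B (z, y)].

Lemma luzin_closed B :
  (forall (z : cantor_space) y, (forall n, exists2 z' : cantor_space,
     B (z', y) & mkseq z' n = mkseq z n) -> B (z, y)) -> luzin B.
Proof.
move=> cB; exists (fun _ _ => setT); split=> [_ _|_ x _|sg z y H].
- by apply: borel_open; apply: openT.
- by exists 0%N.
- by apply: cB => n; have [z' [? _ ?]] := H n; exists z'.
Qed.

(** The scheme for an intersection interleaves the schemes of the F j. *)
Lemma luzin_bigcap (F : nat -> set (cantor_space * Y)) :
  (forall j, luzin (F j)) -> luzin [set x | forall j, F j x].
Proof.
move=> /choice[D DP].
pose E n k := if unpickle n is Some ji then D ji.1 ji.2 k else setT.
exists E; split=> [n k|n x Fx|sg z y H j].
- rewrite /E; case: unpickle => [ji|]; first by case: (DP ji.1).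
  by apply: borel_open; apply: openT.
- rewrite /E; case: unpickle => [ji|]; last by exists 0%N.
  by case: (DP ji.1) => _ + _; apply.
- case: (DP j) => _ _ /(_ (fun i => sg (pickle (j, i)))); apply=> n.
  pose m := (\max_(i < n) pickle (j, i : nat) + n).+1.
  have [z' [Fz' Dz' zz']] := H m; exists z'; split=> //.
  + move=> i lin; have := Dz' (pickle (j, i)); rewrite /E pickleK; apply.
    rewrite ltnS (leq_trans _ (leq_addr _ _))//.
    exact: (@leq_bigmax _ (fun i : 'I_n => pickle (j, i : nat)) (Ordinal lin)).
  + by apply: mkseq_le zz'; rewrite leqW// leq_addl.
Qed.

(** The first cover decides which F j is aimed at. The later ones come from the
    schemes of all F j, each enlarged by the complement of F j so that it covers
    the union; for the j aimed at, the complement is never chosen. *)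
Lemma luzin_bigcup (F : nat -> set (cantor_space * Y)) :
  (forall j, luzin (F j)) -> (forall j, borel (F j)) ->
  luzin [set x | exists j, F j x].
Proof.
move=> /choice[D DP] bF.
have sa := borel_sigma_algebra (cantor_space * Y)%type.
pose E n k := if n is n'.+1 then
    if unpickle n' is Some ji then
      if k is k'.+1 then [set x | F ji.1 x /\ D ji.1 ji.2 k' x]
      else [set x | ~ F ji.1 x]
    else setT
  else F k.
exists E; split=> [[|n] k|[|n] x Fx|sg z y H].
- exact: bF.
- rewrite /E; case: unpickle => [ji|]; last by apply: borel_open; apply: openT.
  case: k => [|k]; first by apply: (salg_not sa); apply: bF.
  by apply: (salg_and sa); [apply: bF|have [bD _ _] := DP ji.1; apply: bD].
- exact: Fx.
- rewrite /E; case: unpickle => [ji|]; last by exists 0%N.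
  have [Fji|nF] := pselect (F ji.1 x); last by exists 0%N.
  have [_ + _] := DP ji.1 => /(_ ji.2 x Fji)[k Dk].
  by exists k.+1.
- pose j := sg 0%N; exists j.
  have [_ _ /(_ (fun i => (sg (pickle (j, i)).+1).-1))] := DP j; apply=> n.
  pose m := (\max_(i < n) pickle (j, i : nat) + n).+2.
  have [z' [_ Dz' zz']] := H m; exists z'.
  have Fz' : F j (z', y) := Dz' 0%N isT.
  split=> //; last by apply: mkseq_le zz'; rewrite 2?leqW// leq_addl.
  move=> i lin; have := Dz' (pickle (j, i)).+1; rewrite /E pickleK.
  have -> : ((pickle (j, i)).+1 < m)%N.
    rewrite !ltnS (leq_trans _ (leq_addr _ _))//.
    exact: (@leq_bigmax _ (fun i : 'I_n => pickle (j, i : nat)) (Ordinal lin)).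
  by move=> /(_ isT); case: (sg _) => [|k []].
Qed.

Definition rectangles : set (set (cantor_space * Y)) :=
  [set A | (exists n : nat, A = [set x : cantor_space * Y | x.1 n]) \/
           (exists2 C : set Y, borel C & A = [set x | C x.2])].

(** The Borel sets that have a Luzin scheme together with their complement form
    a sigma-algebra. *)
Lemma rectangles_luzin A : <<s rectangles>> A -> borel A /\ luzin A.
Proof.
suff : <<s rectangles>> `<=` [set A | [/\ borel A, luzin A & luzin (~` A)]].
  by move=> sub /sub[].
have sa := borel_sigma_algebra (cantor_space * Y)%type.
apply: smallest_sub; first split=> [|B [bB lB lCB]|F FP].
- split; first by case: sa.
  + by apply: luzin_closed => z y /(_ 0%N)[].
  + by apply: luzin_closed => z y _ [].
- rewrite setTD; split=> //; first exact: (salg_not sa (P := B)).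
  by rewrite setCK.
- have lF : luzin (\bigcup_n F n).
    have -> : \bigcup_n F n = [set x | exists n, F n x].
      by apply/seteqP; split=> x [n]; exists n.
    by apply: luzin_bigcup => n; case: (FP n).
  split=> //; first by case: sa => _ _; apply=> n; case: (FP n).
  have -> : ~` (\bigcup_n F n) = [set x | forall n, (~` F n) x].
    by apply/seteqP; split=> x /= nF => [n Fn|[n _]]; [apply: nF; exists n|apply: nF].
  by apply: luzin_bigcap => n; case: (FP n).
- move=> A' [[n ->]|[C bC ->]]; split.
  + exact: borel_coordinate.
  + apply: luzin_closed => z y /(_ n.+1)[z' /= z'n].
    by move=> /(congr1 (nth false ^~ n)); rewrite !nth_mkseq// => <-.
  + apply: luzin_closed => z y /(_ n.+1)[z' /= z'n].
    by move=> /(congr1 (nth false ^~ n)); rewrite !nth_mkseq// => <-.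
  + exact: borel_snd.
  + by apply: luzin_closed => z y /(_ 0%N)[].
  + by apply: luzin_closed => z y /(_ 0%N)[].
Qed.

Variables (R : realType) (I : set (set cantor_space)).
Hypotheses (I_sigma : sigma_ideal I) (I_bob : borel_on_borel R I) (Y_polish : polish R Y).

(** The greedy selection: at step n, keep the first member of the n-th cover,
    split according to the n-th bit of z, whose intersection with what has been
    kept so far still has a section not in I. Such a member exists because
    I is closed under countable unions, and the bits decided in
    this way define zeta. *)
Lemma luzin_uniformization B : borel B -> luzin B ->
  exists zeta : Y -> cantor_space, (forall n, borel [set y | zeta y n]) /\
    forall y, ~ I [set z | B (z, y)] -> B (zeta y, y).
Proof.
case: I_sigma => I0 Isub IU bB [D [bD Dcov Dlim]].
have saZ := borel_sigma_algebra (cantor_space * Y)%type.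
have saY := borel_sigma_algebra Y.
(* the parity of k is the n-th bit of z *)
pose E n k : set (cantor_space * Y) := [set x | D n k./2 x /\ x.1 n = odd k].
have bE n k : borel (E n k).
  apply: (salg_and saZ); first exact: bD.
  have bt := borel_coordinate n.
  case: (odd k) => //.
  have -> : [set x : cantor_space * Y | x.1 n = false] =
      [set x : cantor_space * Y | ~ x.1 n].
    by apply/seteqP; split=> x /= => [->//|/negP/negPf].
  exact: (salg_not saZ).
pose small A n k y := I [set z : cantor_space | A (z, y) /\ E n k (z, y)].
pose pick A n y k := ~ small A n k y /\ forall j : 'I_k, small A n j y.
pose S := fix S n := if n is m.+1 then
  [set x | exists k, pick (S m) m x.2 k /\ S m x /\ E m k x] else B.
have bsmall A n k : borel A -> borel [set y | small A n k y].
  move=> bA; apply: (I_bob Y_polish (A := [set x | A x /\ E n k x])).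
  by apply: (salg_and saZ); [exact: bA|exact: bE].
have bpick A n k : borel A -> borel [set y | pick A n y k].
  move=> bA; apply: (salg_and saY); first by apply: (salg_not saY); apply: bsmall.
  by apply: (salg_forall saY) => j; apply: bsmall.
have bS n : borel (S n).
  elim: n => // n IH; apply: (salg_exists saZ) => k; apply: (salg_and saZ).
    exact: borel_snd (bpick _ _ _ IH).
  by apply: (salg_and saZ); [exact: IH|exact: bE].
have SB n x : S n x -> B x by elim: n => // n IH [k [_ []]] /IH.
have pick_uniq A n y k k' : pick A n y k -> pick A n y k' -> k = k'.
  move=> [nk lk] [nk' lk']; have [lt|lt|//] := ltngtP k k'.
    by case: nk; apply: (lk' (Ordinal lt)).
  by case: nk'; apply: (lk (Ordinal lt)).
exists (fun y n => `[< exists k, pick (S n) n y k /\ odd k >]); split=> [n|y nI].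
  have -> : [set y | `[< exists k, pick (S n) n y k /\ odd k >]] =
      [set y | exists k, pick (S n) n y k /\ odd k].
    by apply/seteqP; split=> y /= /asboolP.
  apply: (salg_exists saY) => k; apply: (salg_and saY); first exact: bpick.
  exact: (salg_const saY).
have ex_pick n : ~ I [set z | S n (z, y)] -> exists k, pick (S n) n y k.
  move=> nIS.
  have [k nk] : exists k, `[< ~ small (S n) n k y >].
    apply: contrapT => /forallNP all; apply: nIS.
    apply: Isub (IU (fun k => [set z | S n (z, y) /\ E n k (z, y)]) _); last first.
      by move=> k; apply: contrapT => nk; apply: (all k); apply/asboolP.
    move=> z /= Sz; have [k Dk] := Dcov n _ (SB _ _ Sz).
    exists (z n + k.*2)%N => //; split=> //; rewrite /E /= half_bit_double.
    by rewrite oddD odd_double addbF oddb.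
  have exk : exists k, (fun k => `[< ~ small (S n) n k y >]) k by exists k.
  case: (ex_minnP exk) => m /asboolP nm mmin; exists m; split=> // j.
  apply: contrapT => /asboolP/mmin; by rewrite leqNgt ltn_ord.
have nIS n : ~ I [set z | S n (z, y)].
  elim: n => // n /[dup] IH /ex_pick[k kP]; case: (kP) => nk _ IS; apply: nk.
  by apply: Isub IS => z [Sz Ez]; exists k.
have [sg sgP] := choice (fun n => ex_pick n (nIS n)).
have zetaE n : `[< exists k, pick (S n) n y k /\ odd k >] = odd (sg n).
  apply/asboolP/idP => [[k [kP ok]]|o]; last by exists (sg n).
  by rewrite (pick_uniq _ _ _ _ _ (sgP n) kP).
have SE n z : S n (z, y) -> forall i, (i < n)%N -> E i (sg i) (z, y).
  elim: n => // n IH [k [kP [Sz Ez]]] i; rewrite ltnS leq_eqVlt.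
  case/predU1P => [->|]; last exact: IH.
  by rewrite (pick_uniq _ _ _ _ _ (sgP n) kP).
apply: (Dlim (fun i => (sg i)./2)) => n.
have [z Sz] : exists z, S n (z, y).
  apply: contrapT => /forallNP e; apply: (nIS n).
  by have [A IA] := I0; apply: Isub IA => z /e.
exists z; split; first exact: SB Sz.
- by move=> i /(SE _ _ Sz)[].
- apply/(@eq_from_nth _ false); rewrite !size_mkseq// => i lin.
  by rewrite !nth_mkseq// zetaE; have [_ <-] := SE _ _ Sz _ lin.
Qed.

End Uniformization.

(** * The Borel hierarchy along a well-ordering *)

Definition code_row (c : nat -> nat) (k i : nat) : nat := c (pickle (k, i)).

Definition code_of_rows (r : nat -> nat -> nat) (i : nat) : nat :=
  let: (k, j) := odflt (0%N, 0%N) (unpickle i) in r k j.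

Lemma code_of_rowsK r k : code_row (code_of_rows r) k = r k.
Proof. by apply/funext => i; rewrite /code_row /code_of_rows pickleK. Qed.

(** A level of the hierarchy is Some n, for n in the field of R, or None, which
    lies above all of them. *)
Definition below (R : rel nat) (o : option nat) (m : nat) : bool :=
  R m m && (if o is Some n then [&& R n n, R m n & m != n] else true).

Definition code_tail (r : nat -> nat) (i : nat) : nat := r i.+1.

Section Hierarchy.
Variables (X : Type) (O : nat -> set X).

(** The first entry of the code r is a flag: m.+1 requests the complement of a set
    of level m, and 0 requests a basic open set. A request for a level that is
    not below o is read as a request for a basic open set, so that every code is
    meaningful. *)
Definition hierarchy_piece (R : rel nat) (V : option nat -> (nat -> nat) -> set X)
    o r : set X :=
  if (0 < r 0)%N && below R o (r 0%N).-1
  then ~` V (Some (r 0%N).-1) (code_tail r)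
  else O (r 1%N).

Definition hierarchy R (V : option nat -> (nat -> nat) -> set X) : Prop :=
  forall o c, V o c = \bigcup_k hierarchy_piece R V o (code_row c k).

Definition below_rel R (o' o : option nat) : Prop :=
  if o' is Some m then below R o m else False.

Lemma below_wf R : well_ordering R -> well_founded (below_rel R).
Proof.
move=> woR; have AccS n : Acc (below_rel R) (Some n).
  apply: contrapT => nA; pose C : {pred nat} :=
    [pred m | R m m && ~~ `[< Acc (below_rel R) (Some m) >]].
  have CF : {subset C <= wo_field R} by move=> m /andP[].
  have [|z [[]]] := woR C CF.
    exists n; rewrite inE; apply/andP; split; last by apply/asboolPn.
    apply: contrapT => /negP/negPf nR; apply: nA.
    by apply: Acc_intro => -[m /andP[_ /andP[]]|[]]; rewrite nR.
  rewrite inE => /andP[Rz /asboolPn nAz] zmin _; apply: nAz.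
  apply: Acc_intro => -[m|[]] /andP[Rm /and3P[_ Rmz mz]]; apply: contrapT => nAm.
  have Cm : m \in C by rewrite inE Rm; apply/asboolPn.
  have Rzm := zmin _ Cm.
  move/eqP: mz; apply; apply: (wochoice.wo_chain_antisymmetric woR) => //.
  by rewrite Rmz Rzm.
move=> [n|]; first exact: AccS.
by apply: Acc_intro => -[m _|[]]; apply: AccS.
Qed.

Lemma hierarchy_exists R : well_ordering R -> exists V, hierarchy R V.
Proof.
move=> /below_wf wf.
pose step o (f : forall o', below_rel R o' o -> (nat -> nat) -> set X) c :=
  \bigcup_k (let r := code_row c k in
    match pselect ((0 < r 0)%N /\ below_rel R (Some (r 0%N).-1) o) with
    | left p => ~` f _ p.2 (code_tail r)
    | right _ => O (r 1%N)
    end).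
exists (Fix wf (fun _ => (nat -> nat) -> set X) step) => o c.
rewrite Fix_eq => [|o1 f g fg].
  apply: eq_bigcup => // k _; rewrite /hierarchy_piece /=.
  case: pselect => [[p1 p2]|np]; first by rewrite p1 p2.
  by case: ifP => // /andP.
have -> // : f = g.
by apply: functional_extensionality_dep => o2; apply: functional_extensionality_dep.
Qed.

(** Renaming the levels inside a code along a strictly increasing f; levels that
    are not below o are replaced by the flag 0. *)
Lemma hierarchy_embedding (R R' : rel nat) V V' (f : nat -> nat) :
    well_ordering R -> hierarchy R V -> hierarchy R' V' ->
    (forall m n, below R (Some n) m -> below R' (Some (f n)) (f m)) ->
  forall o o' c, (forall m, below R o m -> below R' o' (f m)) ->
    exists c', V o c = V' o' c'.
Proof.
move=> /below_wf wf hV hV' fmono o; elim/(well_founded_ind wf): o.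
move=> o IH o' c fo.
have ex k : exists r', hierarchy_piece R V o (code_row c k) = hierarchy_piece R' V' o' r'.
  rewrite /hierarchy_piece; case: ifP => [/andP[r0 rb]|_]; last first.
    by exists (fun i => if i is 0 then 0%N else code_row c k i).
  have [c' ->] := IH (Some (code_row c k 0).-1) rb (Some (f (code_row c k 0).-1))
    (code_tail (code_row c k)) (fun m => fmono m _).
  exists (fun i => if i is i'.+1 then c' i' else (f (code_row c k 0).-1).+1) => /=.
  by rewrite fo.
have [r' r'P] := choice ex.
exists (code_of_rows r'); rewrite hV hV'; apply: eq_bigcup => // k _.
by rewrite r'P code_of_rowsK.
Qed.

(** Joint measurability in the point and in the code, for maps phi and kappa that
    are themselves measurable. *)
Lemma hierarchy_measurable (T : Type) (S : set (set T)) R V (phi : T -> X)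
    (kappa : T -> nat -> nat) :
    sigma_algebra setT S -> well_ordering R -> hierarchy R V ->
    (forall i, S [set t | O i (phi t)]) ->
    (forall i k, S [set t | kappa t i = k]) ->
  forall o, S [set t | V o (kappa t) (phi t)].
Proof.
move=> saS /below_wf wf hV Sphi + o; elim/(well_founded_ind wf): o kappa.
move=> o IH kappa Skappa.
have -> : [set t | V o (kappa t) (phi t)] =
    [set t | exists k, hierarchy_piece R V o (code_row (kappa t) k) (phi t)].
  by apply/seteqP; split=> t; rewrite /= hV => -[k]; [exists k|exists k].
apply: (salg_exists saS) => k.
pose P (ab : nat * nat) t := if (0 < ab.1)%N && below R o ab.1.-1
  then ~ V (Some ab.1.-1) (code_tail (code_row (kappa t) k)) (phi t) else O ab.2 (phi t).
have -> : [set t | hierarchy_piece R V o (code_row (kappa t) k) (phi t)] =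
    [set t | P (code_row (kappa t) k 0%N, code_row (kappa t) k 1%N) t].
  by apply/seteqP; split=> t; rewrite /= /hierarchy_piece /P /=; case: ifP.
apply: (salg_countable_valued saS) => [[a b]|[a b]].
  have -> : [set t | (code_row (kappa t) k 0%N, code_row (kappa t) k 1%N) = (a, b)] =
      [set t | kappa t (pickle (k, 0%N)) = a /\ kappa t (pickle (k, 1%N)) = b].
    by apply/seteqP; split=> t [<- <-].
  by apply: (salg_and saS).
rewrite /P /=.
have [/andP[_ ab]|_] := boolP ((0 < a)%N && below R o a.-1); last exact: Sphi.
apply: (salg_not saS); apply: (IH (Some a.-1) ab) => i j.
exact: Skappa.
Qed.

Definition of_rank (R : rel nat) (B : set X) : Prop :=
  exists V c, hierarchy R V /\ B = V None c.

Lemma order_iso_rank R S B : well_ordering R -> well_ordering S ->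
  order_iso R S -> of_rank R B -> of_rank S B.
Proof.
move=> woR woS [f fbij fiso] [V [c [hV ->]]].
have [V' hV'] := hierarchy_exists woS.
have [_ finj _] := fbij.
have [||c' cE] := @hierarchy_embedding R S V V' f woR hV hV' _ None None c.
- move=> m n /andP[Rm /and3P[Rn Rmn mn]].
  rewrite /below !fiso//; rewrite Rm Rn Rmn /=.
  by apply: contra_neq mn => /finj; apply; rewrite inE.
- by move=> m /andP[Rm _]; rewrite /below fiso// Rm.
by exists V', c'.
Qed.

Local Notation slot := (@pickle (nat * option nat)%type).

(** The ordinal sum of the R k, each followed by one additional greatest element,
    which is the level at which the set of the k-th block appears. *)
Definition block_le (R : nat -> rel nat) (p q : nat * option nat) : bool :=
  [&& (if p.2 is Some m then R p.1 m m else true),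
      (if q.2 is Some n then R q.1 n n else true) &
      (p.1 < q.1)%N || ((p.1 == q.1) && match p.2, q.2 with
        | _, None => true
        | Some m, Some n => R p.1 m n
        | None, Some _ => false
        end)].

(** [pickle_inv] rather than [unpickle], since the former has at most one
    preimage for each pair. *)
Definition block_sum (R : nat -> rel nat) : rel nat := fun a b =>
  match pickle_inv a, pickle_inv b with
  | Some p, Some q => block_le R p q
  | _, _ => false
  end.

Lemma block_sumE R (p q : nat * option nat) :
  block_sum R (slot p) (slot q) = block_le R p q.
Proof. by rewrite /block_sum !pickleK_inv. Qed.

Lemma block_sum_field R a : block_sum R a a -> exists2 p, a = slot p & block_le R p p.
Proof.
rewrite /block_sum; have := @pickle_invK (nat * option nat)%type a.
by case: (pickle_inv a) => //= p <- h; exists p.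
Qed.

Lemma block_sum_well_ordering R : (forall k, well_ordering (R k)) ->
  well_ordering (block_sum R).
Proof.
move=> woR; apply: wochoice.antisymmetric_wo_chain.
  move=> _ _ /block_sum_field[[k o] -> ko] /block_sum_field[[k' o'] -> ko'].
  rewrite !block_sumE => /andP[/and3P[/= Ho Ho' lt] /and3P[/= _ _ lt']].
  have kk' : k = k'.
    move: lt lt'; case: ltngtP => //=.
  move: lt lt' Ho Ho'; rewrite {}kk' ltnn eqxx /= {ko ko'}.
  case: o o' => [m|] [n|] //= Rmn Rnm Rm Rn.
  suff -> : m = n by [].
  by apply: (wochoice.wo_chain_antisymmetric (woR k')); rewrite ?Rmn.
move=> A Afield [a Aa].
have exk : exists k, `[< exists o, (slot (k, o)) \in A >].
  have [[k o] aE _] := block_sum_field (Afield _ Aa).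
  by exists k; apply/asboolP; exists o; rewrite -aE.
case: (ex_minnP (P := fun k => `[< exists o, (slot (k, o)) \in A >]) exk) => k.
move=> /asboolP[w Akw] kmin.
have kmin' k' o' : slot (k', o') \in A -> (k <= k')%N.
  by move=> Ak'; apply: kmin; apply/asboolP; exists o'.
have fieldA p : slot p \in A -> block_le R p p.
  by move=> /Afield; rewrite inE block_sumE.
have [[m Akm]|nA] := pselect (exists m, slot (k, Some m) \in A).
  pose C : {pred nat} := [pred m | slot (k, Some m) \in A].
  have CF : {subset C <= wo_field (R k)}.
    by move=> n; rewrite !inE => /fieldA/and3P[].
  have [|z [[Cz zmin] _]] := woR k C CF; first by exists m.
  have Rz := CF _ Cz.
  exists (slot (k, Some z)); split=> // b Ab.
  have [[k' o'] bE le] := block_sum_field (Afield _ Ab).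
  rewrite bE in Ab |- *; rewrite block_sumE; apply/and3P; split=> //=.
    by case/and3P: le.
  have := kmin' _ _ Ab; rewrite leq_eqVlt => /orP[/eqP kk'|->//].
  rewrite kk' ltnn eqxx /=; case: o' Ab {bE le} => // n; rewrite -kk' => Ab.
  by apply: zmin; rewrite inE.
case: w Akw => [m|] Akw; first by case: nA; exists m.
exists (slot (k, None)); split=> // b Ab.
have [[k' o'] bE le] := block_sum_field (Afield _ Ab).
rewrite bE in Ab |- *; rewrite block_sumE; apply/and3P; split=> //=.
  by case/and3P: le.
have := kmin' _ _ Ab; rewrite leq_eqVlt => /orP[/eqP kk'|->//].
rewrite kk' ltnn eqxx /=; case: o' Ab {bE le} => // n; rewrite -kk' => Ab.
by case: nA; exists n.
Qed.

Lemma ranked_bigcupC (F : nat -> set X) :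
    (forall k, exists2 R, well_ordering R & of_rank R (F k)) ->
  exists2 R, well_ordering R & of_rank R (\bigcup_k ~` F k).
Proof.
move=> FR; have {FR} exR k : exists R, well_ordering R /\ of_rank R (F k).
  by have [R] := FR k; exists R.
have [R RP] := choice exR.
have woS : well_ordering (block_sum R).
  by apply: block_sum_well_ordering => k; case: (RP k).
exists (block_sum R) => //.
have [V hV] := hierarchy_exists woS.
have exc k : exists c, F k = V (Some (slot (k, None))) c.
  have [woR [Vk [c [hVk ->]]]] := RP k.
  apply: (@hierarchy_embedding (R k) (block_sum R) Vk V
    (fun m => slot (k, Some m)) woR hVk hV) => [m n|m].
    move=> /andP[Rm /and3P[Rn Rmn mn]].
    rewrite /below !block_sumE /block_le /= !ltnn !eqxx /= Rm Rn Rmn /=.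
    by apply: contra_neq mn => /(pcan_inj pickleK)[].
  move=> /andP[Rm _].
  rewrite /below !block_sumE /block_le /= !ltnn !eqxx /= Rm /=.
  by apply/eqP => /(pcan_inj pickleK).
have [c cP] := choice exc.
exists V, (code_of_rows (fun k i => if i is i'.+1 then c k i'
  else (slot (k, None)).+1)); split=> //.
rewrite hV; apply: eq_bigcup => // k _; rewrite code_of_rowsK /hierarchy_piece /=.
have -> : below (block_sum R) None (slot (k, None)).
  by rewrite /below block_sumE /block_le /= eqxx orbT.
by rewrite cP.
Qed.

End Hierarchy.

(** Countable ordinals are closed under countable sums with successors, hence the
    sets of countable rank form a sigma-algebra. *)
Lemma borel_ranked (X : topologicalType) (O : nat -> set X) :
    (forall U, open U -> exists c : nat -> nat, U = \bigcup_k O (c k)) ->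
  forall B, borel B -> exists2 R, well_ordering R & of_rank O R B.
Proof.
move=> Obase.
have ranked_open U : open U -> exists2 R, well_ordering R & of_rank O R U.
  (* the empty relation leaves only the level None *)
  move=> /Obase[c ->]; pose R : rel nat := fun _ _ => false.
  have woR : well_ordering R.
    by move=> A AR [m /AR].
  exists R => //; have [V hV] := hierarchy_exists O woR.
  exists V, (code_of_rows (fun k i => if i == 1%N then c k else 0%N)); split=> //.
  rewrite hV; apply: eq_bigcup => // k _.
  by rewrite code_of_rowsK /hierarchy_piece.
have rankedC B : (exists2 R, well_ordering R & of_rank O R B) ->
    exists2 R, well_ordering R & of_rank O R (~` B).
  move=> BR; have := ranked_bigcupC (fun _ : nat => BR).
  by rewrite bigcup_const//; exists 0%N.
apply: smallest_sub; last by move=> U /ranked_open.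
split=> [|A /= AR|F FR].
- by apply: ranked_open; apply: open0.
- by rewrite setTD; apply: rankedC.
- have -> : \bigcup_k F k = \bigcup_k ~` (~` F k).
    by apply: eq_bigcup => // k _; rewrite setCK.
  by apply: ranked_bigcupC => k; apply: rankedC.
Qed.

(** * Haar-small Borel sets of unbounded rank *)

Lemma dense_sequence (R : realType) (X : topologicalZmodType) (W : nat -> set X) :
  polish R X -> group_scale W ->
  exists d : nat -> X, forall n x, exists i, W n (x - d i).
Proof.
move=> [[D cD dD] _] sW.
have /pcard_injP[f finj] := cD.
exists (fun i => xget 0 [set x | D x /\ f x = i]) => n x.
have [|y [/= Wy Dy]] := dD [set y | W n (y - x)] _ (open_shift x (scale_open sW n)).
  by exists x; rewrite /= subrr; apply: (scale0 sW).
exists (f y).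
have -> : xget 0 [set y' | D y' /\ f y' = f y] = y.
  apply: xget_subset1; first by [].
  move=> u v [Du fu] [Dv fv]; apply: finj; rewrite ?inE//.
  by rewrite fu fv.
exact: (scale_distC sW).
Qed.

Section Basis.
Variables (X : topologicalZmodType) (W : nat -> set X) (d : nat -> X).
Hypotheses (scaleW : group_scale W) (d_dense : forall n x, exists i, W n (x - d i)).

(** Index 0 codes the empty set, which pads enumerations of the basic sets that
    an open set contains. *)
Definition basic_open (j : nat) : set X :=
  if j is j'.+1 then
    let: (i, n) := odflt (0%N, 0%N) (unpickle j') in [set x | W n (x - d i)]
  else set0.

Lemma basic_open_open j : open (basic_open j).
Proof.
case: j => [|j] /=; first exact: open0.
by case: (odflt _ _) => i n; apply: open_shift; apply: (scale_open scaleW).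
Qed.

Lemma open_basic U : open U -> exists c : nat -> nat, U = \bigcup_k basic_open (c k).
Proof.
move=> oU; exists (fun k => if `[< basic_open k `<=` U >] then k else 0%N).
apply/seteqP; split=> [x Ux|x [k _]]; last by case: asboolP => // kU /kU.
have [n _ nU] := scale_near scaleW 0 (open_nbhs_nbhs (conj oU Ux)).
have [i xi] := d_dense n.+1 x.
have bE : basic_open (pickle (i, n.+1)).+1 = [set x | W n.+1 (x - d i)].
  by rewrite /basic_open pickleK.
exists (pickle (i, n.+1)).+1 => //; case: asboolP; first by rewrite bE.
case; rewrite bE => y yi; apply: nU.
by apply: (scale_tri scaleW yi); apply: (scale_distC scaleW).
Qed.

Lemma approx_measurable (T : Type) (S : set (set T)) (phi : T -> X) (psi : nat -> T -> X) :
    sigma_algebra setT S -> (forall n t, W (6 * n + 3)%N (phi t - psi n t)) ->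
    (forall n P, S [set t | P (psi n t)]) ->
  forall U, open U -> S (phi @^-1` U).
Proof.
move=> saS near Spsi U oU.
have -> : phi @^-1` U = [set t | exists n,
    forall y, W (6 * n + 3)%N (y - psi n t) -> U y].
  apply/seteqP; split=> [t Ut|t [n]]; last exact.
  have [n _ nU] := scale_near scaleW 0 (open_nbhs_nbhs (conj oU Ut)).
  exists n => y yn; apply: nU; apply: (scale_mono scaleW (m := 6 * n + 2)%N).
    by lia.
  apply: (scale_tri scaleW (y := psi n t)); rewrite -addnS//.
  exact: (scale_distC scaleW).
apply: (salg_exists saS) => n.
exact: Spsi n [set x | forall y, W (6 * n + 3)%N (y - x) -> U y].
Qed.

End Basis.

Lemma sigma_ideal_proper_setC (T : Type) (I : set (set T)) A :
  sigma_ideal I -> ~ I setT -> I A -> ~ I (~` A).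
Proof.
move=> [_ _ IU] nI IA ICA; apply: nI.
have -> : [set: T] = \bigcup_n (if n == 0%N then A else ~` A).
  apply/seteqP; split=> // x _; have [Ax|nAx] := pselect (A x).
    by exists 0%N.
  by exists 1%N.
by apply: IU => n; case: ifP.
Qed.

Lemma neq_mkseq (p p' : nat -> nat) : p <> p' -> exists n, mkseq p n.+1 != mkseq p' n.+1.
Proof.
move=> pp'; apply: contrapT => /forallNP same; apply: pp'; apply/funext => n.
have /negP/negPn/eqP/(congr1 (nth 0%N ^~ n)) := same n.
by rewrite !nth_mkseq.
Qed.

Section Construction.
Variables (R : realType) (X : topologicalZmodType) (W : nat -> set X).
Hypotheses (X_polish : polish R X) (scaleW : group_scale W).
Hypothesis spreadW : forall n (l : seq X),
  exists2 a, W n a & forall b, b \in l -> ~ W n.+1 (a - b).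

Let Xcm : completely_metrizable R X. Proof. by case: X_polish. Qed.
Let Xh : hausdorff_space X. Proof. exact: completely_metrizable_hausdorff Xcm. Qed.

(** The translations themselves, for one-point pieces, embed the Baire space in
    X; g is the restriction of this embedding to the Cantor space. Its partial
    sums give the finite sets D n that approximate the differences of points in
    the image of g. *)
Lemma cantor_embedding : exists (g : cantor_space -> X) (D : nat -> seq X),
  [/\ continuous g, injective g, forall n, 0 \in D n &
      forall n z z', exists2 r, r \in D n & W (6 * n + 3)%N (g z - g z' - r)].
Proof.
have [T [t [tT Tsep]]] :=
  spread_translations scaleW Xcm spreadW (fun=> [:: 0]) (fun=> [:: 0]).
pose num (z : cantor_space) (i : nat) : nat := z i.
have tW p p' n : W (6 * n + 3)%N
    (t p - t p' - (T n (mkseq p n.+1) - T n (mkseq p' n.+1))).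
  have -> : t p - t p' - (T n (mkseq p n.+1) - T n (mkseq p' n.+1)) =
    (t p - T n (mkseq p n.+1)) - (t p' - T n (mkseq p' n.+1)) by zmod.
  by apply: (scaleB scaleW); rewrite -addnS.
exists (t \o num).
exists (fun n => [seq T n w - T n w' |
  w <- [seq map nat_of_bool w | w : n.+1.-tuple bool],
  w' <- [seq map nat_of_bool w | w : n.+1.-tuple bool]]).
have words n (z : cantor_space) :
    mkseq (num z) n.+1 \in [seq map nat_of_bool w | w : n.+1.-tuple bool].
  have zn : size (mkseq z n.+1) == n.+1 by rewrite size_mkseq.
  apply/mapP; exists (Tuple zn); first by rewrite mem_enum.
  by rewrite /mkseq -map_comp.
split.
- move=> z V /(scale_near scaleW 0)[n _ nV].
  apply: filterS (cylinder_nbhs z n.+1) => z' zz'; apply: nV.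
  have e : mkseq (num z') n.+1 = mkseq (num z) n.+1.
    have := congr1 (map nat_of_bool) zz'.
    by rewrite /mkseq -!map_comp.
  apply: (scale_mono scaleW (m := 6 * n + 3)%N); first by lia.
  by have := tW (num z') (num z) n; rewrite e subrr subr0.
- move=> z z' /= tzz'; suff : num z = num z'.
    move=> e; apply/funext => i; have := congr1 (@^~ i) e.
    by rewrite /num; do 2 case: (_ i).
  apply: contrapT => /neq_mkseq[n /(Tsep n)].
  move=> /(_ 0 0 0 (mem_head _ _) (mem_head _ _) (mem_head _ _)); apply.
  rewrite subr0 !add0r; apply: (scale_mono scaleW (m := 6 * n + 3)%N); first by lia.
  have := tW (num z') (num z) n; rewrite tzz'.
  by have -> : forall a b c : X, a - a - (b - c) = c - b by move=> a b c; zmod.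
- move=> n; pose w := mkseq (num (fun=> false)) n.+1.
  rewrite -(subrr (T n w)).
  by apply: (allpairs_f (fun w w' => T n w - T n w')); apply: words.
- move=> n z z'; exists (T n (mkseq (num z) n.+1) - T n (mkseq (num z') n.+1)).
    by apply: (allpairs_f (fun w w' => T n w - T n w')); apply: words.
  exact: tW.
Qed.

Variable d : nat -> X.
Hypothesis d_dense : forall n x, exists i, W n (x - d i).

(** The hypotheses below are what [cantor_embedding], [spread_translations] and
    [locconst_sum] provide. *)
Let Q s := table_sums W d (size s) s.

Variables (D : nat -> seq X) (T : nat -> seq nat -> X) (t : (nat -> nat) -> X)
  (ev : (nat -> nat) -> cantor_space -> X).
Hypothesis D0 : forall n, 0 \in D n.
Hypothesis tT : forall p n, W (6 * n + 4)%N (t p - T n (mkseq p n.+1)).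
Hypothesis T_separated : forall n s s', s != s' ->
  forall q q' r, q \in Q s -> q' \in Q s' -> r \in D n ->
  ~ W (6 * n).+1 ((q + T n s) - (q' + T n s') - r).
Hypothesis ev_sum : forall p z n,
  W (6 * n + 4)%N (ev p z - \sum_(i < n.+1) locconst W d i (p i) z).

(** The point of the piece over p that has the parameter z. *)
Definition place (p : nat -> nat) z := ev p z + t p.

Definition place_approx n (p : nat -> nat) z :=
  \sum_(i < n.+1) locconst W d i (p i) z + T n (mkseq p n.+1).

Lemma place_near n (p : nat -> nat) z : W (6 * n + 3)%N (place p z - place_approx n p z).
Proof.
have -> : place p z - place_approx n p z = (ev p z -
    \sum_(i < n.+1) locconst W d i (p i) z) + (t p - T n (mkseq p n.+1)).
  by rewrite /place /place_approx; zmod.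
by apply: (scaleD scaleW); rewrite -addnS.
Qed.

(** An open neighbourhood of all pieces over the p that extend s. *)
Definition cell n s : set X :=
  [set x | exists q, q \in Q s /\ W (6 * n + 3)%N (x - (q + T n s))].

Lemma cell_separated n s s' x x' r : s != s' -> cell n s x -> cell n s' x' ->
  r \in D n -> ~ W (6 * n + 2)%N (x - x' - r).
Proof.
move=> ss' [q [qs xq]] [q' [qs' xq']] rD xx'.
apply: (T_separated ss' qs qs' rD).
have -> : q + T n s - (q' + T n s') - r =
   (x - x' - r) - ((x - (q + T n s)) - (x' - (q' + T n s'))) by zmod.
apply: (scaleB scaleW); first by rewrite -addn2.
by rewrite -addn2; apply: (scaleB scaleW); rewrite -addnS.
Qed.

Lemma place_cell n (p : nat -> nat) z : cell n (mkseq p n.+1) (place p z).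
Proof.
exists (\sum_(i < n.+1) locconst W d i (p i) z); split; last exact: place_near.
rewrite /Q size_mkseq.
have -> : \sum_(i < n.+1) locconst W d i (p i) z =
    \sum_(i < n.+1) locconst W d i (nth 0%N (mkseq p n.+1) i) z.
  by apply: eq_bigr => i _; rewrite nth_mkseq.
exact: locconst_table_sums.
Qed.

Lemma translation_cell n (p : nat -> nat) : cell n (mkseq p n.+1) (t p).
Proof.
exists 0; split; first exact: table_sums0.
by rewrite add0r; apply: (scale_mono scaleW _ (tT p n)); rewrite leq_add2l.
Qed.

Definition decode (x : X) (n : nat) : nat :=
  xget 0%N [set k | exists s, cell n (rcons s k) x].

Lemma cell_uniq n s s' x : cell n s x -> cell n s' x -> s = s'.
Proof.
move=> cs cs'; apply/eqP; apply: contrapT => /negP ss'.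
apply: (cell_separated ss' cs cs' (D0 n)); rewrite subrr subr0.
exact: (scale0 scaleW).
Qed.

Lemma cell_decode p x : (forall n, cell n (mkseq p n.+1) x) -> decode x = p.
Proof.
move=> cp; apply/funext => n; apply: xget_subset1.
  by exists (mkseq p n); rewrite -mkseqS.
move=> k k' [s cs] [s' cs'].
by have /rcons_inj[] := cell_uniq cs cs'.
Qed.

Lemma decode_place p z : decode (place p z) = p.
Proof. by apply: cell_decode => n; apply: place_cell. Qed.

Lemma decode_translation p : decode (t p) = p.
Proof. by apply: cell_decode => n; apply: translation_cell. Qed.

Lemma cell_open n s : open (cell n s).
Proof.
have -> : cell n s = \bigcup_(q in [set q | q \in Q s])
    [set x | W (6 * n + 3)%N (x - (q + T n s))].
  by apply/seteqP; split=> x [q]; [case=> qs ?; exists q|move=> qs ?; exists q].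
by apply: bigcup_open => q _; apply: open_shift; apply: (scale_open scaleW).
Qed.

Lemma decode_borel n k : borel [set x | decode x n = k].
Proof.
have saX := borel_sigma_algebra X.
pose A j := [set x | exists s, cell n (rcons s j) x].
have bA j : borel (A j).
  by apply: (salg_exists saX) => s; apply: borel_open; apply: cell_open.
have -> : [set x | decode x n = k] =
    [set x | ~ A k x -> (forall j, ~ A j x) /\ k = 0%N].
  rewrite /decode; apply/seteqP; split=> x /=.
    case: xgetP => [j -> Aj <- /(_ Aj)//|noA <- _].
    by split=> // j; apply: noA.
  move=> h; have [Ak|nAk] := pselect (A k x).
    apply: xget_subset1 => // j j' [s cs] [s' cs'].
    by have /rcons_inj[] := cell_uniq cs cs'.
  have [noA ->] := h nAk; case: xgetP => // j _ /noA//.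
apply: (salg_imply saX); first by apply: (salg_not saX); apply: bA.
apply: (salg_and saX); last exact: (salg_const saX).
by apply: (salg_forall saX) => j; apply: (salg_not saX); apply: bA.
Qed.

Section PlaceMeasurable.
Variables (U : Type) (S : set (set U)) (zu : U -> cantor_space) (pu : U -> nat -> nat).
Hypotheses (saS : sigma_algebra setT S) (Szu : forall i, S [set u | zu u i])
  (Spu : forall i k, S [set u | pu u i = k]).

(** The n-th partial sum takes countably many values; P may depend on u so that
    the sum can be compared with a point that varies with u. *)
Lemma locconst_sum_measurable (s : seq nat) n (P : X -> U -> Prop) :
  (forall x, S [set u | P x u]) ->
  S [set u | P (\sum_(i < n) locconst W d i (nth 0%N s i) (zu u)) u].
Proof.
elim: n P => [|n IH] P SP.
  have -> : [set u | P (\sum_(i < 0) locconst W d i (nth 0%N s i) (zu u)) u] =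
    [set u | P 0 u] by apply/seteqP; split=> u; rewrite /= big_ord0.
  exact: SP.
pose P' (w : seq bool) u :=
  P (\sum_(i < n) locconst W d i (nth 0%N s i) (zu u) +
     nth 0 (table W d n (nth 0%N s n)) (pickle w)) u.
have -> : [set u | P (\sum_(i < n.+1) locconst W d i (nth 0%N s i) (zu u)) u] =
    [set u | P' (mkseq (zu u) (parse_code (nth 0%N s n)).2.1) u].
  by apply/seteqP; split=> u; rewrite /= big_ord_recr.
apply: (salg_countable_valued saS) => [w|w].
  apply: (salg_mkseq saS) => i [|]; first exact: Szu.
  have -> : [set u | zu u i = false] = [set u | ~ zu u i].
    by apply/seteqP; split=> u /= => [->//|/negP/negPf].
  exact: (salg_not saS).
exact: (IH (fun x u => P (x + nth 0 (table W d n (nth 0%N s n)) (pickle w)) u)).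
Qed.

Lemma place_approx_measurable n (P : X -> U -> Prop) :
  (forall x, S [set u | P x u]) ->
  S [set u | P (place_approx n (pu u) (zu u)) u].
Proof.
move=> SP; pose P' (s : seq nat) u :=
  P (\sum_(i < n.+1) locconst W d i (nth 0%N s i) (zu u) + T n s) u.
have -> : [set u | P (place_approx n (pu u) (zu u)) u] =
    [set u | P' (mkseq (pu u) n.+1) u].
  have e u : place_approx n (pu u) (zu u) = \sum_(i < n.+1)
      locconst W d i (nth 0%N (mkseq (pu u) n.+1) i) (zu u) + T n (mkseq (pu u) n.+1).
    by congr (_ + _); apply: eq_bigr => i _; rewrite nth_mkseq.
  by apply/seteqP; split=> u; rewrite /= /P' e.
apply: (salg_countable_valued saS) => [s|s]; first exact: (salg_mkseq saS).
exact: (locconst_sum_measurable s n.+1 (P := fun x u => P (x + T n s) u)).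
Qed.

End PlaceMeasurable.

Lemma translation_decode_borel A : borel A -> borel [set x | A (t (decode x))].
Proof.
have saX := borel_sigma_algebra X.
apply: (borel_preimage saX (f := fun x => t (decode x))).
apply: (approx_measurable scaleW (psi := fun n x => T n (mkseq (decode x) n.+1)) saX).
  by move=> n x; apply: (scale_mono scaleW _ (tT _ n)); rewrite leq_add2l.
move=> n P; apply: (salg_countable_valued saX
  (c := fun x => mkseq (decode x) n.+1) (P := fun s _ => P (T n s))) => [s|s].
  by apply: (salg_mkseq saX) => i k; apply: decode_borel.
exact: (salg_const saX).
Qed.

Variable I : set (set cantor_space).
Hypotheses (I_sigma : sigma_ideal I) (I_bob : borel_on_borel R I)
  (I_cover : \bigcup_(A in I) A = [set: cantor_space])
  (I_proper : ~ I [set: cantor_space]).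
Variables (g : cantor_space -> X).
Hypotheses (g_cont : continuous g) (g_inj : injective g).
Hypothesis gD : forall n z z',
  exists2 r, r \in D n & W (6 * n + 3)%N (g z - g z' - r).

(** Two points of E over different codes differ by no element of K - K, where K
    is the image of g, and E has at most one point over each code. So K
    meets each translate of E in at most one point. *)
Lemma haar_transversal (E : set X) (p0 : X -> cantor_space) :
  (forall x, E x -> x = place (decode x) (p0 (t (decode x)))) -> haar I E.
Proof.
move=> Eplace; exists g => // x.
have [I0 Isub IU] := I_sigma.
have sing z z' : E (g z - x) -> E (g z' - x) -> z = z'.
  move=> Ez Ez'; have [same|/neq_mkseq[n neq]] :=
      pselect (decode (g z - x) = decode (g z' - x)).
    apply: g_inj; apply: (addIr (- x)).
    by rewrite (Eplace _ Ez) (Eplace _ Ez') same.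
  have [r rD Wr] := gD n z z'.
  have c1 := place_cell n (decode (g z - x)) (p0 (t (decode (g z - x)))).
  have c2 := place_cell n (decode (g z' - x)) (p0 (t (decode (g z' - x)))).
  rewrite -Eplace// in c1; rewrite -Eplace// in c2.
  case: (cell_separated neq c1 c2 rD).
  have -> : g z - x - (g z' - x) - r = g z - g z' - r by zmod.
  by apply: (scale_mono scaleW _ Wr); rewrite leq_add2l.
have preE z : (g @^-1` [set a + x | a in E]) z -> E (g z - x).
  by move=> [a Ea <-]; have -> : a + x - x = a by zmod.
have [[z /preE Ez]|/forallNP none] :=
    pselect (exists z, (g @^-1` [set a + x | a in E]) z).
  have : (\bigcup_(A in I) A) z by rewrite I_cover.
  move=> [A IA Az]; apply: Isub IA => z' /preE Ez'.
  by rewrite (sing z' z).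
by have [A IA] := I0; apply: Isub IA => z /none.
Qed.

(** The section of B over the point t(p) consists of the z for which the point of
    the piece over p escapes from the set of the hierarchy coded by p. *)
Lemma haar_borel_avoiding (S : rel nat) V : well_ordering S ->
    hierarchy (basic_open W d) S V ->
  exists E : set X, [/\ borel E, haar I E &
    forall c, haar I (V None c) -> ~ (E `<=` V None c)].
Proof.
move=> woS hV.
have saX := borel_sigma_algebra X.
pose code y i := (parse_code (decode y i)).1.
pose B : set (cantor_space * X) :=
  [set x | ~ V None (code x.2) (place (decode x.2) x.1)].
have [bB lB] : borel B /\ luzin B.
  apply: rectangles_luzin; have saR := smallest_sigma_algebra setT (@rectangles X).
  have dec_rect i k : <<s @rectangles X>> [set x | decode x.2 i = k].
    apply: sub_sigma_algebra; right; exists [set y | decode y i = k] => //.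
    exact: decode_borel.
  apply: (salg_not saR); apply: (hierarchy_measurable
    (phi := fun x => place (decode x.2) x.1) saR woS hV).
    move=> i; apply: (approx_measurable scaleW
      (psi := fun n x => place_approx n (decode x.2) x.1) saR);
      last exact: basic_open_open.
      by move=> n x; apply: place_near.
    move=> n P; apply: (place_approx_measurable saR _ dec_rect n (P := fun x _ => P x)).
      by move=> j; apply: sub_sigma_algebra; left; exists j.
    by move=> x; apply: (salg_const saR).
  move=> i k; apply: (salg_countable_valued saR (c := fun x => decode x.2 i)
    (P := fun j _ => (parse_code j).1 = k)) => // j.
  exact: (salg_const saR).
have [zeta [bzeta zetaB]] := luzin_uniformization I_sigma I_bob X_polish bB lB.
pose E := [set x | ~ I [set z | B (z, t (decode x))] /\
  x = place (decode x) (zeta (t (decode x)))].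
exists E; split.
- apply: (salg_and saX).
    apply: (salg_not saX).
    apply: (translation_decode_borel (A := [set y | I [set z | B (z, y)]])).
    exact: I_bob.
  have -> : [set x | x = place (decode x) (zeta (t (decode x)))] =
      [set x | forall n, W (6 * n + 3)%N
        (x - place_approx n (decode x) (zeta (t (decode x))))].
    apply/seteqP; split=> x /= => [xE n|xW]; first by rewrite {1}xE; apply: place_near.
    apply: (scale_separated scaleW Xh) => n.
    apply: (scale_mono scaleW (m := 6 * n + 2)%N); first by lia.
    apply: (scale_tri scaleW); rewrite -addnS; first exact: xW.
    by apply: (scale_distC scaleW); apply: place_near.
  apply: (salg_forall saX) => n.
  apply: (place_approx_measurable (zu := fun x => zeta (t (decode x))) saX _ decode_borel n
    (P := fun v x => W (6 * n + 3)%N (x - v))).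
    by move=> i; apply: (translation_decode_borel (A := [set y | zeta y i])).
  move=> v; apply: borel_open; apply: open_shift; exact: (scale_open scaleW).
- by apply: (haar_transversal (p0 := zeta)) => x [].
- move=> c [f cf fI] EV.
  have [p [pc pf]] := locconst_expansion scaleW d_dense c cf.
  have evf z : ev p z = f z.
    apply: (scale_separated scaleW Xh) => n.
    apply: (scale_mono scaleW (m := 6 * n + 3)%N); first by lia.
    apply: (scale_tri scaleW); rewrite -addnS; first exact: ev_sum.
    apply: (scale_distC scaleW); apply: (scale_mono scaleW _ (pf n z)).
    by rewrite leq_add2l.
  have codeE : code (t p) = c.
    by apply/funext => i; rewrite /code decode_translation pc.
  (* the complement of this section is the preimage under f of a translate of
     V None c *)
  have nI : ~ I [set z | B (z, t p)].
    have -> : [set z | B (z, t p)] = ~` (f @^-1` [set a - t p | a in V None c]).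
      apply/seteqP; split=> z; rewrite /B /= codeE decode_translation /place evf.
        by move=> nV [a Va fa]; apply: nV; rewrite -fa subrK.
      by move=> n Va; apply: n; exists (f z + t p) => //; rewrite addrK.
    exact: sigma_ideal_proper_setC.
  have := zetaB _ nI; rewrite /B /= codeE decode_translation; apply; apply: EV.
  by rewrite /E /= decode_place.
Qed.

End Construction.

Lemma haar_borel_unbounded (R : realType) (I : set (set cantor_space))
    (X : topologicalZmodType) :
    sigma_ideal I -> borel_on_borel R I ->
    \bigcup_(A in I) A = [set: cantor_space] -> ~ I [set: cantor_space] ->
    polish R X -> ~ locally_compact [set: X] ->
  exists O : nat -> set X,
    (forall U, open U -> exists c : nat -> nat, U = \bigcup_k O (c k)) /\
    forall S, well_ordering S -> exists E : set X, [/\ borel E, haar I E &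
      forall B, of_rank O S B -> haar I B -> ~ (E `<=` B)].
Proof.
move=> I_sigma I_bob I_cover I_proper Xp nlc.
have [_ Xcm] := Xp.
have [W scaleW spreadW] := spread_scale_exists Xcm nlc.
have [d d_dense] := dense_sequence Xp scaleW.
have [g [D [g_cont g_inj D0 gD]]] := cantor_embedding Xp scaleW spreadW.
have [T [t [tT Tsep]]] := spread_translations scaleW Xcm spreadW
  (fun s => table_sums W d (size s) s) D.
have [ev ev_sum] := locconst_sum scaleW Xcm d.
exists (basic_open W d); split; first exact: open_basic.
move=> S woS; have [V hV] := hierarchy_exists (basic_open W d) woS.
have [E [bE hE EV]] := haar_borel_avoiding Xp scaleW d_dense D0 tT Tsep ev_sum
  I_sigma I_bob I_cover I_proper g_cont g_inj gD woS hV.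
exists E; split=> // B [V' [c [hV' ->]]].
have [//|//|c' ->] :=
  hierarchy_embedding (f := id) woS hV' hV _ (o := None) (o' := None) c.
exact: EV.
Qed.

(** * The additivity *)

(** Take a maximal set P of choice functions on F that pairwise differ at every
    member of F. By maximality the values of P exhaust some A in F; as distinct
    functions in P differ at B as well, sending f(A) to f(B) is an
    injection of A into B. *)
Lemma least_cardinal (T : Type) (F : set (set T)) : F !=set0 ->
  exists2 A, F A & forall B, F B -> A #<= B.
Proof.
move=> [A0 FA0].
pose sections (P : set (set T -> T)) := forall f, P f -> forall A, F A -> A (f A).
pose disjoint (P : set (set T -> T)) :=
  forall f h, P f -> P h -> forall A, F A -> f A = h A -> f = h.
have [P [[Psec Pdis] Pmax]] : exists P, (sections P /\ disjoint P) /\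
    forall Q, P `<` Q -> ~ (sections Q /\ disjoint Q).
  apply: (@Zorn_bigcup _ [set P | sections P /\ disjoint P]) => G GP Gtot.
  split=> [f [P GPP Pf]|f h [P GP1 Pf] [Q GQ Qh]].
    by case: (GP _ GPP) => c _; apply: c Pf.
  have [PQ|QP] := Gtot P Q GP1 GQ.
    by case: (GP _ GQ) => _; apply=> //; apply: PQ.
  by case: (GP _ GP1) => _; apply=> //; apply: QP.
have [A FA Asurj] : exists2 A, F A & forall a, A a -> exists2 f, P f & f A = a.
  apply: contrapT => /forall2NP noA.
  have missed A : F A -> exists a, A a /\ forall f, P f -> f A <> a.
    move=> FA; have [//|/existsNP[a /not_implyP[Aa nf]]] := noA A.
    by exists a; split=> // f Pf fa; apply: nf; exists f.
  have [a0 _] := missed _ FA0.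
  have exf A : exists a, F A -> A a /\ forall f, P f -> f A <> a.
    have [/missed[a ?]|nFA] := pselect (F A); first by exists a.
    by exists a0.
  have [f0 f0P] := choice exf.
  apply: (Pmax (P `|` [set f0])).
    split=> [f Pf|/(_ f0 (or_intror erefl)) Pf0]; first by left.
    by have [_ /(_ _ Pf0)] := f0P _ FA0.
  split=> [f [Pf|->] A FA|f h [Pf|->] [Ph|->] A FA //].
  - exact: Psec Pf A FA.
  - by have [] := f0P _ FA.
  - exact: Pdis Pf Ph A FA.
  - by have [_ /(_ _ Pf)] := f0P _ FA.
  - by have [_ /(_ _ Ph) n /esym] := f0P _ FA.
exists A => // B FB.
have [[a0 /Asurj[f0 _ _]]|A_empty] := pselect (exists a, A a); last first.
  have -> : A = set0 by apply/seteqP; split=> // a Aa; case: A_empty; exists a.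
  exact: card_ge0.
have exf a : exists f, A a -> P f /\ f A = a.
  have [/Asurj[f]|nA] := pselect (A a); first by exists f.
  by exists f0.
have [phi phiP] := choice exf.
have inj : {in A &, injective (fun a => phi a B)}.
  move=> a b; rewrite !inE => /phiP[Pa aE] /phiP[Pb bE] ab.
  by rewrite -aE -bE (Pdis _ _ Pa Pb B FB ab).
rewrite -(card_le_eql (inj_card_eq inj)).
by apply: subset_card_le => _ [a /phiP[Pa _] <-]; apply: Psec Pa B FB.
Qed.

Lemma order_iso_refl (R : rel nat) : order_iso R R.
Proof. by exists id => //; split=> // n Rn; exists n. Qed.

Theorem corollary14p1 (R : realType) (I : set (set cantor_space))
    (I_sigma : sigma_ideal I) (I_bob : borel_on_borel R I)
    (I_cover : \bigcup_(A in I) A = [set: cantor_space])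
    (I_proper : ~ I [set: cantor_space])
    (X : topologicalZmodType) (X_polish : polish R X)
    (X_nlc : ~ locally_compact [set: X]) :
  exists2 A : set (set X), is_add (HI I X) A & A #<= omega1.
Proof.
have [base [base_open unbounded]] :=
  haar_borel_unbounded I_sigma I_bob I_cover I_proper X_polish X_nlc.
have exE S : exists E : set X, well_ordering S -> [/\ borel E, haar I E &
    forall B, of_rank base S B -> haar I B -> ~ (E `<=` B)].
  have [/unbounded[E ?]|nS] := pselect (well_ordering S); first by exists E.
  by exists set0.
have [E EP] := choice exE.
have exrep tau : exists S, omega1 tau -> well_ordering S /\ order_type S = tau.
  have [[S woS <-]|ntau] := pselect (omega1 tau); first by exists S.
  by exists (fun _ _ => false).
have [rep repP] := choice exrep.
pose A0 := (E \o rep) @` omega1.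
have A0_bad : A0 `<=` HI I X /\ ~ HI I X (\bigcup_(B in A0) B).
  split=> [_ [tau /repP[woS _] <-]|[B [A0B bB hB]]].
    by have [? ? _] := EP _ woS; exists (E (rep tau)); split.
  have [S woS SB] := borel_ranked base_open bB.
  have tau_omega1 : omega1 (order_type S) by exists S.
  have [woS' repE] := repP _ tau_omega1.
  have [_ SS'] : order_type S (rep (order_type S)).
    by rewrite -{1}repE; split=> //; apply: order_iso_refl.
  have [_ _ /(_ B (order_iso_rank woS woS' SS' SB) hB)] := EP _ woS'; apply.
  apply: subset_trans A0B; apply: bigcup_sup.
  by exists (order_type S).
have [|A [AHI Abad] Amin] := @least_cardinal (set X)
  [set A | A `<=` HI I X /\ ~ HI I X (\bigcup_(B in A) B)]; first by exists A0.
exists A; last exact: card_le_trans (Amin _ A0_bad) (card_image_le _ _).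
by split=> // A' A'HI A'bad; apply: Amin.
Qed.
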